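(* Let $T$ be a complete $\mathcal L$-theory and let $\mathfrak C\models T$ be a monster model. The following are equivalent: (1) $T$ is NIP. (2) For every single variable $x$, the dynamical system $(S_x(\mathfrak C),\mathrm{Aut}(\mathfrak C))$ is tame. (3) For every single variable $x$, $\beta(S_x(\mathfrak C),\mathrm{Aut}(\mathfrak C))<\infty$. (4) For every single variable $x$, if $f\in E(S_x(\mathfrak C),\mathrm{Aut}(\mathfrak C))$ then $\beta(f)<w(S_x(\mathfrak C))^+$.
   Context: $T$ is NIP if no formula $\varphi(x,y)$ ($x,y$ finite tuples) has the independence property modulo $T$. A monster model is a $\kappa$-saturated and strongly $\kappa$-homogeneous model for some big cardinal $\kappa$ (strongly $\kappa$-homogeneous: every partial elementary map with domain of size $<\kappa$ extends to an automorphism). For a model $M$, $S_x(M)$ is the Stone space of complete types over $M$ in the variables $x$, and $\mathrm{Aut}(M)$ (with the topology of pointwise convergence) acts on it by $\varphi(x,g(b))\in g\cdot p\iff\varphi(x,b)\in p$. A dynamical system $(X,G)$ is a compact Hausdorff space $X$ with a topological group $G$ acting continuously on $X$ by homeomorphisms; $(S_x(M),\mathrm{Aut}(M))$ is one. $\mathcal U$ denotes the unique compatible uniformity of $X$, i.e. the set of all neighbourhoods of the diagonal in $X\times X$. The Ellis semigroup $E(X,G)$ is the closure of $\{x\mapsto gx: g\in G\}$ in $X^X$ with the product (pointwise convergence) topology. The weight $w(X)$ is the least cardinality of a basis of $X$, and $\kappa^+$ is the successor cardinal of $\kappa$. A function $f:X\to X$ is fragmented if for every non-empty closed $D\subseteq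 X$ and every $W\in\mathcal U$ there is an open $V\subseteq X$ with $D\cap V\neq\emptyset$ and $(f(a),f(b))\in W$ for all $a,b\in D\cap V$. $(X,G)$ is tame if every $f\in E(X,G)$ is fragmented. For $Y\subseteq X$ closed, $f:Y\to X$ (for maps with larger domain use the restriction) and $W\in\mathcal U$, let $(Y)'_{f,W}$ be the set of $y\in Y$ such that for every open neighbourhood $V$ of $y$ in $Y$ there are $v_1,v_2\in V$ with $(f(v_1),f(v_2))\notin W$; this is a closed set. Put $(Y)^0_{f,W}=Y$, $(Y)^{\alpha+1}_{f,W}=((Y)^{\alpha}_{f,W})'_{f,W}$ and $(Y)^{\gamma}_{f,W}=\bigcap_{\alpha<\gamma}(Y)^{\alpha}_{f,W}$ for limit ordinals $\gamma$. Then $\beta(f,W)=\sup\{\alpha\in\mathrm{Ord}: (Y)^\alpha_{f,W}\neq\emptyset\}$, and $\beta(f,W)=\infty$ if $(Y)^\alpha_{f,W}\ne\emptyset$ for all ordinals $\alpha$ ($\infty$ is larger than every ordinal). For $f:X\to X$, $\beta(f)=\sup_{W\in\mathcal U}\beta(f,W)$; and $\beta(X,G)=\sup_{f\in E(X,G)}\beta(f)$. *)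

(* Defs.v *)
From HB Require Import structures.
From mathcomp Require Import all_boot all_order.
From mathcomp Require Import all_classical all_reals all_analysis.

Set Implicit Arguments.
Unset Strict Implicit.
Unset Printing Implicit Defensive.

Local Open Scope classical_set_scope.
Local Open Scope card_scope.

(* First-order logic: one-sorted languages with equality.  Variables are
   natural numbers; constants are function symbols of arity 0. *)

Record language := Language {
  fsym : Type; far : fsym -> nat;
  rsym : Type; rar : rsym -> nat }.

Inductive term (L : language) : Type :=
| tvar of nat
| tapp (f : fsym L) of ('I_(far f) -> term L).
Arguments tvar {L}.

Inductive form (L : language) : Type :=
| fbot
| feq of term L & term L
| frel (r : rsym L) of ('I_(rar r) -> term L)
| fimp of form L & form L
| fall of nat & form L.
Arguments fbot {L}.

Definition fneg L (phi : form L) : form L := fimp phi fbot.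

Fixpoint tfree L (v : nat) (t : term L) : Prop :=
  match t with
  | tvar u => v = u
  | tapp f ts => exists i, tfree v (ts i)
  end.

Fixpoint free L (v : nat) (phi : form L) : Prop :=
  match phi with
  | fbot => False
  | feq t u => tfree v t \/ tfree v u
  | frel r ts => exists i, tfree v (ts i)
  | fimp p q => free v p \/ free v q
  | fall u p => v <> u /\ free v p
  end.

Definition sentence L (phi : form L) : Prop := forall v, ~ free v phi.

Record structure (L : language) := Structure {
  carrier :> Type;
  carrier_inhabited : inhabited carrier;
  fint : forall f : fsym L, ('I_(far f) -> carrier) -> carrier;
  rint : forall r : rsym L, ('I_(rar r) -> carrier) -> Prop }.

Definition upd (A : Type) (s : nat -> A) (x : nat) (a : A) : nat -> A :=
  fun v => if v == x then a else s v.

Fixpoint eval L (M : structure L) (s : nat -> M) (t : term L) : M :=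
  match t with
  | tvar v => s v
  | tapp f ts => fint (fun i => eval s (ts i))
  end.

Fixpoint sat L (M : structure L) (s : nat -> M) (phi : form L) : Prop :=
  match phi with
  | fbot => False
  | feq t u => eval s t = eval s u
  | frel r ts => rint (fun i => eval s (ts i))
  | fimp p q => sat s p -> sat s q
  | fall x p => forall a : M, sat (upd s x a) p
  end.

Definition models L (M : structure L) (T : set (form L)) : Prop :=
  forall phi, T phi -> forall s : nat -> M, sat s phi.

Definition entails L (T : set (form L)) (phi : form L) : Prop :=
  forall M : structure L, models M T -> forall s : nat -> M, sat s phi.

Definition complete_theory L (T : set (form L)) : Prop :=
  [/\ T `<=` @sentence L,
      exists M : structure L, models M T
    & forall phi, sentence phi -> entails T phi \/ entails T (fneg phi)].

(* A partitioned formula phi(x, y) is given by phi and the finite tuple xs of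
   variables making up x; y consists of the other (finitely many) free
   variables of phi.  The tuples substituted for x and y are given by
   assignments, of which only the relevant values are used. *)
Definition split_assignment (A : Type) (xs : seq nat) (a b : nat -> A) :
  nat -> A := fun v => if v \in xs then a v else b v.

Definition has_IP L (T : set (form L)) (phi : form L) (xs : seq nat) : Prop :=
  exists M : structure L, models M T /\
  exists (a : nat -> nat -> M) (b : set nat -> nat -> M),
  forall (i : nat) (I : set nat),
    sat (split_assignment xs (a i) (b I)) phi <-> I i.

Definition NIP L (T : set (form L)) : Prop :=
  forall phi xs, ~ has_IP T phi xs.

(* A formula phi(x, b) with parameters from M, in the single variable x, is
   given by phi and an assignment s of all variables in M; b is the
   restriction of s to the free variables of phi other than x. *)
Definition pform L (M : structure L) : Type := (form L * (nat -> M))%type.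

Definition params_in L (M : structure L) (x : nat) (A : set M) (q : pform M) :=
  forall v, free v q.1 -> v <> x -> A (q.2 v).

Definition psat L (M : structure L) (x : nat) (a : M) (q : pform M) : Prop :=
  sat (upd q.2 x a) q.1.

Definition pneg L (M : structure L) (q : pform M) : pform M := (fneg q.1, q.2).

Definition complete_type L (M : structure L) (x : nat) (A : set M)
    (p : set (pform M)) : Prop :=
  [/\ p `<=` params_in x A,
      forall F : set (pform M), finite_set F -> F `<=` p ->
        exists a : M, F `<=` psat x a
    & forall q, params_in x A q -> p q \/ p (pneg q)].

Definition card_lt (A B : Type) (X : set A) (Y : set B) : Prop :=
  ~~ (Y #<= X).

Record aut L (M : structure L) := Aut {
  aut_fun :> M -> M;
  aut_inv : M -> M;
  aut_funK : cancel aut_fun aut_inv;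
  aut_invK : cancel aut_inv aut_fun;
  aut_fint : forall f (a : 'I_(far f) -> M),
    aut_fun (fint a) = fint (aut_fun \o a);
  aut_rint : forall r (a : 'I_(rar r) -> M),
    rint (aut_fun \o a) <-> rint a }.

(* Cardinals kappa are given by a type K of that cardinality. *)
Definition saturated L (K : Type) (M : structure L) : Prop :=
  forall (A : set M), card_lt A [set: K] ->
  forall (x : nat) (p : set (pform M)), complete_type x A p ->
  exists a : M, p `<=` psat x a.

Definition strongly_homogeneous L (K : Type) (M : structure L) : Prop :=
  forall (A : set M) (h : M -> M), card_lt A [set: K] ->
  (forall (phi : form L) (s : nat -> M), (forall v, free v phi -> A (s v)) ->
     (sat s phi <-> sat (h \o s) phi)) ->
  exists g : aut M, forall a, A a -> g a = h a.

(* There are |L| + aleph_0 formulas, so "big" means kappa > |L| + aleph_0. *)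
Definition monster L (M : structure L) : Prop :=
  exists K : Type, [/\ card_lt [set: form L] [set: K],
    saturated K M & strongly_homogeneous K M].

Record type_space L (M : structure L) (x : nat) := TypeSpace {
  type_set :> set (pform M);
  type_setP : complete_type x setT type_set }.

HB.instance Definition _ L (M : structure L) x :=
  gen_eqMixin (type_space M x).
HB.instance Definition _ L (M : structure L) x :=
  gen_choiceMixin (type_space M x).

Definition clopen_of L (M : structure L) x (q : pform M) :
  set (type_space M x) := [set p | type_set p q].

HB.instance Definition _ L (M : structure L) x :=
  @isSubBaseTopological.Build (type_space M x)
    (set (type_space M x)) (range (@clopen_of L M x)) id.

Lemma eval_aut L (M : structure L) (g : aut M) (s : nat -> M) (t : term L) :
  eval (g \o s) t = g (eval s t).
Proof.
elim: t => [v //|f ts IH] /=; rewrite aut_fint; congr fint.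
by apply/funext => i /=; rewrite IH.
Qed.

Lemma upd_aut L (M : structure L) (g : aut M) (s : nat -> M) x a :
  upd (g \o s) x (g a) = g \o upd s x a.
Proof. by apply/funext => v; rewrite /upd /=; case: eqP. Qed.

Lemma sat_aut L (M : structure L) (g : aut M) (phi : form L) (s : nat -> M) :
  sat (g \o s) phi <-> sat s phi.
Proof.
elim: phi s => [|t u|r ts|p IHp q IHq|x p IH] s //=.
- rewrite !eval_aut; split=> [|->//].
  exact: (can_inj (aut_funK g)).
- have -> : (fun i => eval (g \o s) (ts i)) = g \o (fun i => eval s (ts i)).
    by apply/funext => i; rewrite eval_aut.
  exact: aut_rint.
- by split=> H /IHp/H/IHq.
- split=> H a.
    by apply/IH; rewrite -upd_aut; apply: H.
  by rewrite -(aut_invK g a) upd_aut; apply/IH.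
Qed.

(* Equivalently: phi(x, g(b)) is in g . p if and only if phi(x, b) is in p. *)
Definition act_set L (M : structure L) (g : aut M) (p : set (pform M)) :
  set (pform M) := [set q | p (q.1, aut_inv g \o q.2)].

Lemma act_setP L (M : structure L) (x : nat) (g : aut M)
  (p : type_space M x) : complete_type x setT (act_set g p).
Proof.
have [_ pfin pcpl] := type_setP p; split=> //; last first.
  by move=> q _; apply: (pcpl (q.1, aut_inv g \o q.2)).
move=> F Ffin Fp.
have [a aF] : exists a : M,
    [set (q.1, aut_inv g \o q.2) | q in F] `<=` psat x a.
  apply: pfin; first exact: finite_image.
  by move=> _ [q Fq <-]; apply: Fp.
exists (g a) => q Fq; rewrite /psat.
have : psat x a (q.1, aut_inv g \o q.2) by apply: aF; exists q.
move=> /(sat_aut g); rewrite -upd_aut /=.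
have -> // : g \o (aut_inv g \o q.2) = q.2.
by apply/funext => v /=; rewrite aut_invK.
Qed.

Definition type_act L (M : structure L) (x : nat) (g : aut M)
  (p : type_space M x) : type_space M x := TypeSpace (act_setP g p).

(* Ordinals: transfinite trees, where oSup g is the supremum of an arbitrary
   family.  Each ordinal has many representatives; ole is the induced total
   preorder. *)

Inductive ord : Type :=
| oZero
| oSucc of ord
| oSup (J : Type) of (J -> ord).

Fixpoint ole (a b : ord) {struct a} : Prop :=
  match a with
  | oZero => True
  | oSucc a' =>
      (fix gt_a' (c : ord) : Prop :=
        match c with
        | oZero => False
        | oSucc c' => ole a' c'
        | oSup J g => exists i, gt_a' (g i)
        end) b
  | oSup J g => forall i, ole (g i) b
  end.

Definition olt (a b : ord) : Prop := ole (oSucc a) b.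

(* An element of Ord \cup {oo} is identified with the class of the ordinals
   below it; suprema are then unions and infima are intersections.  The arrow
   type is used rather than set, so that the universe of ord stays above those
   of the spaces considered. *)
Definition eord : Type := ord -> Prop.

Definition below (a : ord) : eord := fun c => olt c a.
Definition infty : eord := fun=> True.
Definition elt (b c : eord) : Prop :=
  exists a, c a /\ forall d, b d -> olt d a.
Definition esup (I : Type) (P : I -> Prop) (b : I -> eord) : eord :=
  fun c => exists i, P i /\ b i c.
Definition einf (I : Type) (P : I -> Prop) (b : I -> eord) : eord :=
  fun c => forall i, P i -> b i c.

(* Cardinals are initial ordinals: a < |A| if and only if A does not inject
   into the set of ordinals below a. *)
Definition card (U : Type) (A : set U) : eord := fun a =>
  ~ exists f : U -> ord,
      (forall u, A u -> olt (f u) a) /\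
      (forall u v, A u -> A v -> ole (f u) (f v) -> ole (f v) (f u) -> u = v).

Definition succ_card (k : eord) : eord :=
  einf (fun A : Type => elt k (card [set: A])) (fun A => card [set: A]).

Definition weight (X : topologicalType) : eord :=
  einf (@basis X) (@card (set X)).

(* The compatible uniformity of a compact Hausdorff space. *)
Definition uniformity (X : topologicalType) : set (set (X * X)) :=
  [set W | forall x : X, nbhs (x, x) W].

Definition ellis (X : topologicalType) (G : Type) (act : G -> X -> X) :
  set {ptws X -> X} := closure (range (act : G -> {ptws X -> X})).

Definition fragmented (X : topologicalType) (f : X -> X) : Prop :=
  forall (D : set X) (W : set (X * X)),
    closed D -> D !=set0 -> uniformity W ->
    exists V : set X, [/\ open V, D `&` V !=set0 &
      forall a b, (D `&` V) a -> (D `&` V) b -> W (f a, f b)].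

Definition tame (X : topologicalType) (G : Type) (act : G -> X -> X) : Prop :=
  forall f, ellis act f -> fragmented f.

Definition derived (X : topologicalType) (f : X -> X) (W : set (X * X))
    (Y : set X) : set X :=
  [set y | Y y /\ forall V, open V -> V y ->
     exists v1 v2, [/\ (Y `&` V) v1, (Y `&` V) v2 & ~ W (f v1, f v2)]].

(* The iterated derivatives decrease, so intersecting along an arbitrary
   family of ordinals agrees with the value at its supremum, limit or not;
   the outer Y matters for the empty family only. *)
Fixpoint iter_derived (X : topologicalType) (f : X -> X) (W : set (X * X))
    (Y : set X) (a : ord) : set X :=
  match a with
  | oZero => Y
  | oSucc b => derived f W (iter_derived f W Y b)
  | oSup J g => Y `&` \bigcap_(i in [set: J]) iter_derived f W Y (g i)
  end.

Definition beta_at (X : topologicalType) (f : X -> X) (W : set (X * X)) :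
  eord := esup (fun a => iter_derived f W setT a !=set0) below.

Definition beta (X : topologicalType) (f : X -> X) : eord :=
  esup (@uniformity X) (beta_at f).

Definition beta_system (X : topologicalType) (G : Type) (act : G -> X -> X) :
  eord := esup (ellis act) (@beta X).

(* Main.v *)
From Stdlib Require List.
Require Import Defs.
From mathcomp Require finmap.
From mathcomp Require Import all_boot all_order zify.
From mathcomp Require Import all_classical all_reals all_analysis.

(** Write [X] for the space of types in a single variable over the monster
    model.  The rank conditions and tameness are compared by topology alone.  If
    every function of the Ellis semigroup is fragmented, each derivation removes
    a point from a nonempty closed set, so the derivatives for given [f] and [W]
    are pairwise distinct as long as they are nonempty; as there is only a set
    of triples of [f], [W] and a closed set, the ranks are bounded
    ([tame_beta_bounded]).  If they are bounded, a stage is separated from the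
    next one by a basic open set, and an entourage may be replaced by one given
    by finitely many basic open sets, so the stages inject into the finite
    sequences of basic open sets; by Hessenberg's theorem these are no more
    numerous than the elements of an infinite basis ([beta_lt_succ_weight]).
    Finally, a closed set on which [f] is nowhere fragmented survives all
    derivations ([not_fragmented_beta]).  So each of the last three conditions
    says that the system is tame.

    Tameness is compared with NIP through rich formulas, those for which
    arbitrarily long finite families of parameters are independent.  If [f] is
    in the Ellis semigroup and not fragmented, its values oscillate in one
    formula on every open part of some closed set; approximating [f] by
    automorphisms, one conjugates the parameters of this formula so as to split
    all cells of an independent family, and the formula is rich
    ([not_fragmented_rich]).  By saturation a rich formula has an infinite
    independent sequence, which yields the independence property
    ([rich_has_IP]).

    Conversely, the independence property passes from any model to the monster
    model, as the theory is complete ([has_IP_rich]), and from tuples of objects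
    to a single object ([rich_single]): otherwise the Sauer-Shelah lemma bounds
    the number of patterns shown by single objects, hence by induction the
    number of those shown by tuples, by a polynomial in the number of
    parameters.  The independent sequence obtained for a rich formula can be
    chosen with all members of the same type, hence conjugate
    ([rich_sequence]).  Conjugating along it and taking the limit along a
    nonprincipal ultrafilter yields a function of the Ellis semigroup.  On a
    minimal closed set of types realizing all patterns along the sequence, this
    function takes on every open part values that contain the first instance of
    the formula and values that do not ([independent_not_tame]). *)

Set Implicit Arguments.
Unset Strict Implicit.
Unset Printing Implicit Defensive.

Local Open Scope classical_set_scope.

(** * Ordinals *)

Lemma ole_sup_ub (J : Type) (g : J -> ord) i a : ole a (g i) -> ole a (oSup g).
Proof.
elim: a => [//|a _|K h IH] /= H; first by exists i.
by move=> k; apply: IH; apply: H.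
Qed.

Lemma ole_refl a : ole a a.
Proof. by elim: a => [//|a IH //|J g IH] i; apply: ole_sup_ub (IH i). Qed.

Lemma ole_trans b a c : ole a b -> ole b c -> ole a c.
Proof.
elim: b a c => [|b IH|J g IH] a c.
- by elim: a => [//|//|J g IHa] /= H H0 i; apply: IHa (H i) H0.
- move=> + Hbc; elim: a => [//|a _|J g IHa] /= Hab; last by move=> i;
  exact: IHa.
  elim: c Hbc => [//|c _|J g IHc] /= Hbc; first exact: IH Hbc.
  by case: Hbc => i /IHc ?; exists i.
- move=> + Hbc; elim: a => [//|a _|K h IHa] /=; last by move=> H k; exact: IHa.
  by case=> i Hi; apply: (IH i (oSucc a)) (Hbc i).
Qed.

Lemma ole_lt_trans b a c : ole a b -> olt b c -> olt a c.
Proof. exact: (@ole_trans (oSucc b) (oSucc a)). Qed.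

Lemma olt_irrefl a : ~ olt a a.
Proof.
elim: a => [//|a IH //|J g IH] [i Hi]; apply: (IH i).
apply: (@ole_lt_trans (oSup g)) => //.
by apply: ole_sup_ub (ole_refl _).
Qed.

Lemma ole_succ a : ole a (oSucc a).
Proof.
elim: a => [//|a IH|J g IH] /=; first exact: IH.
by move=> i; apply: ole_trans (IH i) _; apply: ole_sup_ub (ole_refl _).
Qed.

Lemma oltW a b : olt a b -> ole a b.
Proof. exact: ole_trans (ole_succ a). Qed.

Lemma ole_or_lt a b : ole a b \/ olt b a.
Proof.
elim: a b => [b|a IHa b|J g IH b]; first by left.
- elim: b => [|b _|K h IHb]; first by right.
    by case: (IHa b); [left|right].
  have [[i Hi]|/forallNP H] := pselect (exists i, ole (oSucc a) (h i)).
    by left; exists i.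
  by right=> i; case: (IHb i) => // Hi; case: (H i).
- have [H|/existsNP[i Hi]] := pselect (forall i, ole (g i) b); first by left.
  by right; exists i; case: (IH i b).
Qed.

(** * Cardinal arithmetic *)

(** The function is total on the ambient type, which avoids default values. *)
Definition embeds (T : Type) (X Y : set T) : Prop :=
  exists f : T -> T, (forall x, X x -> Y (f x)) /\
    (forall x y, X x -> X y -> f x = f y -> x = y).

(** A maximal graph of a partial injection is total or onto. *)
Lemma embeds_total (T : Type) (X Y : set T) : embeds X Y \/ embeds Y X.
Proof.
pose P (G : set (T * T)) := [/\ forall p, G p -> X p.1 /\ Y p.2,
  forall p q, G p -> G q -> p.1 = q.1 -> p = q
  & forall p q, G p -> G q -> p.2 = q.2 -> p = q].
have [F FP Ftot|G [[GXY Gfun Ginj] Gmax]] := @Zorn_bigcup _ P.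
  have common p q : (\bigcup_(G in F) G) p -> (\bigcup_(G in F) G) q ->
      exists2 G, F G & G p /\ G q.
    move=> [G1 F1 G1p] [G2 F2 G2q]; have [s|s] := Ftot _ _ F1 F2.
      by exists G2 => //; split=> //; apply: s.
    by exists G1 => //; split=> //; apply: s.
  split.
  - by move=> p [G FG Gp]; have [H _ _] := FP _ FG; exact: H.
  - by move=> p q /common/[apply] -[G /FP[_ H _] []]; exact: H.
  - by move=> p q /common/[apply] -[G /FP[_ _ H] []]; exact: H.
have [HX|/existsNP[x /not_implyP[Xx nx]]] :=
    pselect (forall x, X x -> exists y, G (x, y)).
  have /choice[f Hf] : forall x, exists y, X x -> G (x, y).
    by move=> x; have [/HX[y]|] := pselect (X x); [exists y|exists x].
  left; exists f; split=> [x /Hf/GXY[]//|x y /Hf Gx /Hf Gy e].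
  by have [] := Ginj _ _ Gx Gy e.
have [HY|/existsNP[y /not_implyP[Yy ny]]] :=
    pselect (forall y, Y y -> exists x, G (x, y)).
  have /choice[f Hf] : forall y, exists x, Y y -> G (x, y).
    by move=> y; have [/HY[z]|] := pselect (Y y); [exists z|exists y].
  right; exists f; split=> [z /Hf/GXY[]//|z t /Hf Gx /Hf Gy e].
  by have [] := Gfun _ _ Gx Gy e.
exfalso; apply: (Gmax (G `|` [set (x, y)])).
  split; last by move=> /(_ (x, y) (or_intror erefl)) Gxy; apply: nx; exists y.
  exact: subsetUl.
split.
- by move=> p [/GXY//|->].
- move=> p q [Gp|->] [Gq|->] //=; first exact: Gfun.
    by move=> e; case: nx; exists p.2; rewrite -e -surjective_pairing.
  by move=> e; case: nx; exists q.2; rewrite e -surjective_pairing.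
- move=> p q [Gp|->] [Gq|->] //=; first exact: Ginj.
    by move=> e; case: ny; exists p.1; rewrite -e -surjective_pairing.
  by move=> e; case: ny; exists q.1; rewrite e -surjective_pairing.
Qed.

Definition square_embeds (T : Type) (X Y : set T) : Prop :=
  exists f : T -> T -> T, (forall x y, X x -> X y -> Y (f x y)) /\
    (forall x y x' y', X x -> X y -> X x' -> X y' ->
       f x y = f x' y' -> x = x' /\ y = y').

Lemma square_embedsW (T : Type) (X X' Y Y' : set T) :
  embeds X X' -> square_embeds X' Y' -> embeds Y' Y -> square_embeds X Y.
Proof.
move=> [i [iX i_inj]] [f [fX f_inj]] [j [jX j_inj]].
exists (fun x y => j (f (i x) (i y))); split=> [x y /iX Xx /iX Xy|].
  exact/jX/fX.
move=> x y x' y' Xx Xy Xx' Xy' /j_inj e.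
have {}e : f (i x) (i y) = f (i x') (i y') by apply: e; apply: fX; apply: iX.
have [] := f_inj _ _ _ _ (iX _ Xx) (iX _ Xy) (iX _ Xx') (iX _ Xy') e.
by move=> /i_inj-> // /i_inj->.
Qed.

(** Elements of [X] and elements of [Y] are told apart by pairing them with two
   distinct tags. *)
Lemma square_embedsU (T : Type) (X Y : set T) (a b : T) :
  X a -> X b -> a <> b -> square_embeds X X -> embeds Y X ->
  embeds (X `|` Y) X.
Proof.
move=> Xa Xb ab [f [fX f_inj]] [g [gX g_inj]].
exists (fun x => if pselect (X x) then f a x else f b (g x)); split.
  by move=> x XYx; case: pselect => Xx; apply: fX => //; apply: gX; case: XYx.
move=> x y Ux Uy; case: pselect => Xx; case: pselect => Xy.
- by move=> /f_inj[].
- have Yy : Y y by case: Uy.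
  by move=> /f_inj[] //; apply: gX.
- have Yx : Y x by case: Ux.
  by move=> /f_inj[] //; [apply: gX|move/esym].
- have Yx : Y x by case: Ux.
  have Yy : Y y by case: Uy.
  by move=> /f_inj[] //; try exact: gX; move=> _ /g_inj; apply.
Qed.

(** A graph of an injection [D * D -> D], where [D] is read off the diagonal. *)
Definition pairing_dom (T : Type) (G : set (T * T * T)) : set T :=
  [set d | exists c, G (d, d, c)].

Definition pairing_graph (T : Type) (G : set (T * T * T)) : Prop :=
  [/\ forall a b c, G (a, b, c) ->
        [/\ pairing_dom G a, pairing_dom G b & pairing_dom G c],
      forall a b, pairing_dom G a -> pairing_dom G b -> exists c, G (a, b, c),
      forall p c c', G (p, c) -> G (p, c') -> c = c'
    & forall p p' c, G (p, c) -> G (p', c) -> p = p'].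

Lemma pairing_graph_embeds (T : Type) (G : set (T * T * T)) :
  pairing_graph G -> square_embeds (pairing_dom G) (pairing_dom G).
Proof.
move=> [Gdom Gtot _ Ginj].
have /choice[f Hf] : forall p, exists c,
    pairing_dom G p.1 -> pairing_dom G p.2 -> G (p.1, p.2, c).
  move=> [a b]; have [/= [Da Db]|n] :=
      pselect (pairing_dom G a /\ pairing_dom G b).
    by have [c Gc] := Gtot _ _ Da Db; exists c.
  by exists a => Da Db; case: n.
exists (fun a b => f (a, b)); split=> [a b Da Db|a b a' b' Da Db Da' Db' e].
  by have [] := Gdom _ _ _ (Hf (a, b) Da Db).
have := Hf (a', b') Da' Db'; rewrite -e => /(Ginj _ _ _ (Hf (a, b) Da Db)).
by case.
Qed.

Lemma pairing_graph_extend (T : Type) (G : set (T * T * T)) (E : set T) :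
  pairing_graph G -> (forall a, E a -> ~ pairing_dom G a) ->
  square_embeds (pairing_dom G `|` E) E ->
  exists G', [/\ pairing_graph G', G `<=` G' & E `<=` pairing_dom G'].
Proof.
move=> [Gdom Gtot Gfun Ginj] ED [h [hE h_inj]];
  set D := pairing_dom G in Gdom Gtot ED hE h_inj *.
pose H := [set p : T * T * T | [/\ (D `|` E) p.1.1, (D `|` E) p.1.2,
  ~ (D p.1.1 /\ D p.1.2) & p.2 = h p.1.1 p.1.2]].
have domE : pairing_dom (G `|` H) = D `|` E.
  apply/seteqP; split=> d.
    by case=> c [Gc|[]//]; left; exists c.
  case=> [[c Gc]|Ed]; first by exists c; left.
  by exists (h d d); right; split=> /=; [right|right|case=> /ED|].
have GD p c : G (p, c) -> D p.1 /\ D p.2 by case: p => a b /Gdom[].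
exists (G `|` H); split; last first.
- by rewrite domE; exact: subsetUr.
- exact: subsetUl.
split; rewrite ?domE.
- move=> a b c [/Gdom[? ? ?]|[/= ? ? _ ->]]; first by split; left.
  by split=> //; right; apply: hE.
- move=> a b Da Db; have [[Da' Db']|n] := pselect (D a /\ D b).
    by have [c Gc] := Gtot _ _ Da' Db'; exists c; left.
  by exists (h a b); right.
- move=> p c c' [Gc|[/= ? ? n ->]] [Gc'|[/= ? ? n' ->]] //.
  + exact: Gfun Gc Gc'.
  + by case: n'; exact: GD Gc.
  + by case: n; exact: GD Gc'.
- move=> [a b] [a' b'] c [Gc|[/= Va Vb n ->]] [Gc'|[/= Ua Ub n' e]] //.
  + exact: Ginj Gc Gc'.
  + have [_ _ Dc] := Gdom _ _ _ Gc.
    by have [] := ED c => //; rewrite e; apply: hE.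
  + have [_ _ Dc] := Gdom _ _ _ Gc'.
    by have [] := ED (h a b) => //; apply: hE.
  + by have [-> ->] := h_inj _ _ _ _ Va Vb Ua Ub e.
Qed.

(** Hessenberg's theorem.  For a maximal graph of an injection [D * D -> D]
   extending a countable one, the complement of [D] contains no copy [E] of [D],
   as the part of [(D `|` E) * (D `|` E)] outside [D * D] could be sent into
   [E]; so the complement embeds into [D], and [D] is equinumerous to the whole
   type. *)
Lemma square_embeds_infinite (T : Type) (e : nat -> T) :
  injective e -> square_embeds (@setT T) setT.
Proof.
move=> e_inj.
pose G0 := [set (e i, e j, e (pickle (i, j))) | i in setT & j in setT].
have G0P i j : G0 (e i, e j, e (pickle (i, j))) by exists i => //; exists j.
have G0good : pairing_graph G0.
  split.
  - move=> _ _ _ [i _ [j _ [<- <- <-]]].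
    by split; eexists; exact: G0P.
  - by move=> _ _ [_ [i _ [i' _ [<- _ _]]]] [_ [j _ [j' _ [<- _ _]]]]; eexists;
    exact: G0P.
  - by move=> _ _ c [i _ [j _ [<- <-]]] [i' _ [j' _ [/e_inj-> /e_inj-> <-]]].
  - move=> _ p c [i _ [j _ [<- <-]]] [i' _ [j' _ [<- /e_inj E]]].
    by have [-> ->] := pcan_inj pickleK E.
have [F Fgood Ftot|G [Ggood Gmax]] :=
    @Zorn_bigcup _ (fun G => pairing_graph (G `|` G0)).
  have [[G1 FG1]|F0] := pselect (exists G, F G); last first.
    suff -> : \bigcup_(G in F) G = set0 by rewrite set0U.
    by apply/seteqP; split=> // p [G FG]; case: F0; exists G.
  have -> : (\bigcup_(G in F) G) `|` G0 = \bigcup_(G in F) (G `|` G0).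
    apply/seteqP; split=> p.
      by case=> [[G FG Gp]|G0p]; [exists G => //; left|exists G1 => //; right].
    by case=> G FG [Gp|]; [left; exists G|right].
  have common p q : (\bigcup_(G in F) (G `|` G0)) p ->
      (\bigcup_(G in F) (G `|` G0)) q ->
      exists2 G, F G & (G `|` G0) p /\ (G `|` G0) q.
    move=> [G FG Gp] [G' FG' G'q]; have [s|s] := Ftot _ _ FG FG'.
      by exists G' => //; split=> //; case: Gp => [/s|]; [left|right].
    by exists G => //; split=> //; case: G'q => [/s|]; [left|right].
  have sub G : F G -> forall d, pairing_dom (G `|` G0) d ->
      pairing_dom (\bigcup_(G in F) (G `|` G0)) d.
    by move=> FG d [c Gc]; exists c, G.
  split.
  - move=> a b c [G FG Gp]; have [H _ _ _] := Fgood _ FG.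
    by have [? ? ?] := H _ _ _ Gp; split; apply: (sub _ FG).
  - move=> a b [c Gc] [c' Gc']; have [G FG [Ga Gb]] := common _ _ Gc Gc'.
    have [_ H _ _] := Fgood _ FG.
    have [||d Gd] := H a b; [by exists c|by exists c'|].
    by exists d, G.
  - move=> p c c' /common/[apply] -[G /Fgood[_ _ H _] []]; exact: H.
  - move=> p p' c /common/[apply] -[G /Fgood[_ _ _ H] []]; exact: H.
set D := pairing_dom (G `|` G0).
have Dsq : square_embeds D D by exact: pairing_graph_embeds.
have De i : D (e i) by exists (e (pickle (i, i))); right; exact: G0P.
have e01 : e 0 <> e 1 by move/e_inj.
have DU Y : embeds Y D -> embeds (D `|` Y) D.
  exact: square_embedsU (De 0) (De 1) e01 Dsq.
have [CD|[f [fD f_inj]]] := embeds_total (~` D) D.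
  have TD : embeds setT D by rewrite -(setUv D); exact: DU.
  by apply: square_embedsW TD Dsq _; exists id.
have fDD : embeds (f @` D) D.
  have /choice[g Hg] : forall y, exists x, (f @` D) y -> D x /\ f x = y.
    move=> y; have [[x Dx <-]|] := pselect ((f @` D) y); first by exists x.
    by exists (e 0).
  exists g; split=> [y /Hg[]//|y y' /Hg[_ yE] /Hg[_ yE'] E].
  by rewrite -yE -yE' E.
have [||G' [G'good GG' EG']] := @pairing_graph_extend _ _ (f @` D) Ggood.
- by move=> _ [x Dx <-]; exact: fD.
- apply: square_embedsW (DU _ fDD) Dsq _; exists f; split=> //.
exfalso; apply: (Gmax G').
  split; first by move=> p Gp; apply: GG'; left.
  move=> G'G; have [|c G'c] := EG' (f (e 0)); first by exists (e 0).
  by apply: (fD _ (De 0)); exists c; left; apply: G'G.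
suff -> : G' `|` G0 = G' by [].
by apply/setUidPl => p G0p; apply: GG'; right.
Qed.

(** Folding an injective pairing over a sequence loses only its length, which is
   recorded separately. *)
Lemma seq_embeds_infinite (T : Type) (e : nat -> T) :
  injective e -> exists f : seq T -> T, injective f.
Proof.
move=> e_inj; have [p [_ p_inj]] := square_embeds_infinite e_inj.
have pI x y x' y' : p x y = p x' y' -> x = x' /\ y = y' by exact: p_inj.
exists (fun s => p (e (size s)) (foldr p (e 0) s)) => s t /pI[/e_inj].
elim: s t => [|x s IH] [|y t] //= [/IH{}IH] /pI[-> /IH->//].
Qed.

(** * Iterated derivatives *)

Section Derivatives.
Variables (X : topologicalType) (f : X -> X).

Lemma derivedS W (Y Z : set X) :
  Y `<=` Z -> derived f W Y `<=` derived f W Z.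
Proof.
move=> YZ y [Yy H]; split=> [|V oV Vy]; first exact: YZ.
have [v [w [[Yv Vv] [Yw Vw] nW]]] := H V oV Vy.
by exists v, w; split=> //; split=> //; exact: YZ.
Qed.

Lemma derived_anti W W' (Y : set X) :
  W `<=` W' -> derived f W' Y `<=` derived f W Y.
Proof.
move=> WW' y [Yy H]; split=> // V oV Vy.
by have [v [w [? ? nW]]] := H V oV Vy; exists v, w; split=> // /WW'.
Qed.

Lemma closed_derived W (Y : set X) : closed Y -> closed (derived f W Y).
Proof.
move=> cY; rewrite -openC openE => y nYy.
have [Yy|nY] := pselect (Y y); last first.
  apply: filterS (open_nbhs_nbhs (conj (closed_openC cY) nY)).
  by move=> z nz [].
move/not_andP: nYy => [//|/existsNP[V /not_implyP[oV /not_implyP[Vy H]]]].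
apply: filterS (open_nbhs_nbhs (conj oV Vy)) => z Vz [_ /(_ V oV Vz)].
exact: H.
Qed.

Lemma iter_derived_sub W (Y : set X) a : iter_derived f W Y a `<=` Y.
Proof.
elim: a => [//|a IH|J g _]; last by move=> y [].
by move=> y [/IH].
Qed.

Lemma iter_derived_le W (Y : set X) a b :
  ole a b -> iter_derived f W Y b `<=` iter_derived f W Y a.
Proof.
elim: a b => [|a IHa|J g IH] b.
- by move=> _; exact: iter_derived_sub.
- elim: b => [//|b _|J g IHb] /=.
    by move=> /IHa; exact: derivedS.
  by case=> i /IHb H y [_ /(_ i I)/H].
- move=> /= H y Dy; split; first exact: iter_derived_sub Dy.
  by move=> i _; apply: IH Dy; exact: H.
Qed.

Lemma iter_derived_anti W W' (Y : set X) a :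
  W `<=` W' -> iter_derived f W' Y a `<=` iter_derived f W Y a.
Proof.
move=> WW'; elim: a => [//|a IH|J g IH] /=.
  exact: subset_trans (derivedS IH) (derived_anti WW').
by move=> y [Yy H]; split=> // i _; apply: IH; exact: H.
Qed.

Lemma closed_iter_derived W (Y : set X) a :
  closed Y -> closed (iter_derived f W Y a).
Proof.
move=> cY; elim: a => [//|a IH|J g IH] /=; first exact: closed_derived.
by apply: closedI => //; apply: closed_bigI => i _.
Qed.

(** A closed set witnessing the failure of fragmentation survives all
   derivations. *)
Lemma not_fragmented_beta :
  ~ fragmented f -> exists2 W, uniformity W & forall c, beta_at f W c.
Proof.
move=> /existsNP[D /existsNP[W /not_implyP[cD /not_implyP[[y Dy]
  /not_implyP[uW H]]]]].
exists W => // c; exists (oSucc c); split; last exact: ole_refl.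
exists y.
suff DS a : D `<=` iter_derived f W setT a by exact: DS.
elim: a => [//|a IH|J g IH] /=; last by move=> z Dz; split=> // i _; exact: IH.
move=> z Dz; split; first exact: IH.
move=> V oV Vz; apply: contrapT => nV; apply: H; exists V; split=> //.
  by exists z.
move=> a' b' [Da Va] [Db Vb]; apply: contrapT => nW; apply: nV.
by exists a', b'; split=> //; split=> //; exact: IH.
Qed.

Lemma fragmented_shrinks W (Y : set X) :
  fragmented f -> uniformity W -> closed Y -> Y !=set0 ->
  exists2 y, Y y & ~ derived f W Y y.
Proof.
move=> ff uW cY Y0; have [V [oV [y [Yy Vy]] VW]] := ff _ _ cY Y0 uW.
exists y => // -[_ /(_ V oV Vy)[v [w [YVv YVw]]]]; apply; exact: VW.
Qed.

(** If one derivation changes nothing, then neither do the following ones, and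
   the derivatives never become empty. *)
Lemma bounded_shrinks W a :
  elt (beta f) infty -> uniformity W -> iter_derived f W setT a !=set0 ->
  exists2 y, iter_derived f W setT a y & ~ iter_derived f W setT (oSucc a) y.
Proof.
move=> [b [_ bP]] uW D0; apply: contrapT => stable.
have {}stable : iter_derived f W setT a `<=` iter_derived f W setT (oSucc a).
  by move=> y Dy; apply: contrapT => nDy; apply: stable; exists y.
have all c : iter_derived f W setT a `<=` iter_derived f W setT c.
  elim: c => [//|c IH|J g IH] /=; last by move=> y Dy; split=> // i _;
    exact: IH.
  exact: subset_trans stable (derivedS IH).
have [y /(all (oSucc b)) Dy] := D0.
apply: (@olt_irrefl b); apply: bP; exists W; split=> //.
exists (oSucc b); split; [by exists y|exact: ole_refl].
Qed.
End Derivatives.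

(** Since the derivatives shrink strictly, a stage is determined by the triple of
   [f], [W] and the derivative; these triples form a small type, over which a
   supremum of ordinals can be taken. *)
Lemma derived_rank (X : topologicalType) (P : (X -> X) -> set (X * X) -> Prop) :
  (forall f W a, P f W -> iter_derived f W setT a !=set0 ->
     exists2 y, iter_derived f W setT a y &
                ~ iter_derived f W setT (oSucc a) y) ->
  exists b, forall d, olt d b <->
    exists f W, P f W /\ iter_derived f W setT d !=set0.
Proof.
move=> shrink.
pose J := {t : (X -> X) * set (X * X) * set X | exists a, [/\ P t.1.1 t.1.2,
  iter_derived t.1.1 t.1.2 setT a = t.2 & t.2 !=set0]}.
have /choice[g Hg] : forall j : J, exists a, [/\ P (sval j).1.1 (sval j).1.2,
    iter_derived (sval j).1.1 (sval j).1.2 setT a = (sval j).2 &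
    (sval j).2 !=set0] by move=> j; exact: (svalP j).
exists (oSup (fun j => oSucc (g j))) => d; split.
  case=> j Hj; have [PfW E D0] := Hg j.
  exists (sval j).1.1, (sval j).1.2; split=> //.
  have [y] := D0; rewrite -E => Dy; exists y.
  exact: iter_derived_le Dy.
move=> [f [W [PfW D0]]].
have Pj : exists a, [/\ P f W,
  iter_derived f W setT a = iter_derived f W setT d &
  iter_derived f W setT d !=set0] by exists d.
pose j : J := exist _ (f, W, iter_derived f W setT d) Pj.
suff: ole d (g j) by exists j.
have [_ /= E _] := Hg j.
have [//|gd] := ole_or_lt d (g j).
have [|y Dy nDy] := shrink f W (g j) PfW; first by rewrite E.
by case: nDy; apply: (iter_derived_le gd); rewrite -E.
Qed.

Lemma tame_beta_bounded (X : topologicalType) (G : Type) (act : G -> X -> X) :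
  tame act -> elt (beta_system act) infty.
Proof.
move=> tameX.
have [|b bP] := @derived_rank X (fun f W => ellis act f /\ uniformity W).
  move=> f W a [/tameX ff uW] D0.
  have [|y Dy nDy] := fragmented_shrinks ff uW _ D0; last by exists y.
  exact/closed_iter_derived/closedT.
exists b; split=> // d [f [Ef [W [uW [a [[y Dy] da]]]]]].
apply/bP; exists f, W; split=> //; exists y.
exact: iter_derived_le (oltW da) _ Dy.
Qed.

(** * Ranks and weight *)

(** Compactness as an induction principle: the complements of the members of an
   ideal form a filter, and no neighbourhood of a cluster point of this filter
   is in the ideal. *)
Lemma compact_ideal (X : topologicalType) (P : set X -> Prop) :
  compact (@setT X) -> (forall A B, A `<=` B -> P B -> P A) -> P set0 ->
  (forall A B, P A -> P B -> P (A `|` B)) ->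
  (forall x : X, exists2 V, nbhs x V & P V) -> P setT.
Proof.
move=> cX Psub P0 PU Ploc; apply: contrapT => nPT.
pose F := [set A : set X | P (~` A)].
have FF : ProperFilter F.
  split; first by rewrite /F /= setC0.
  split; first by rewrite /F /= setCT.
    by move=> A B FA FB; rewrite /F /= setCI; exact: PU.
  by move=> A B AB; apply: Psub; exact: subsetC.
have [|x [_ xF]] := cX F FF; first by rewrite /F /= setCT.
have [V nV PV] := Ploc x.
have nVV : F (~` V) by rewrite /F /= setCK.
by have [y []] := xF _ _ nVV nV.
Qed.

(** By compactness, finitely many basic open sets that are small for [W] cover
   the space.  Up to refinement, this leaves as many entourages as there are
   finite sequences of basic open sets. *)
Lemma uniformity_basis (X : topologicalType) (B : set (set X))
    (W : set (X * X)) :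
  compact (@setT X) -> basis B -> uniformity W ->
  exists s : seq {U : set X | B U},
    (forall x, exists2 U, List.In U s & sval U x)  /\
    [set p | exists2 U, List.In U s & sval U p.1 /\ sval U p.2] `<=` W.
Proof.
move=> cX [Bo Bnbhs] uW.
pose P (A : set X) := exists s : seq {U : set X | B U},
    (forall x, A x -> exists2 U, List.In U s & sval U x)  /\
    [set p | exists2 U, List.In U s & sval U p.1 /\ sval U p.2] `<=` W.
suff [s [sT sW]] : P setT by exists s; split=> // x; exact: sT.
apply: compact_ideal => //.
- by move=> A A' AA' [s [sA sW]]; exists s; split=> // x /AA'; exact: sA.
- by exists [::]; split=> // p [U].
- move=> A A' [s [sA sW]] [s' [sA' sW']]; exists (s ++ s'); split.
    move=> x [Ax|Ax].
      by have [U Us Ux] := sA x Ax; exists U => //; apply/List.in_or_app; left.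
    by have [U Us Ux] := sA' x Ax; exists U => //; apply/List.in_or_app; right.
  by move=> p [U Us Up]; case: (List.in_app_or _ _ _ Us) => Us';
    [apply: sW|apply: sW']; exists U.
- move=> x; have [[V V'] /= [nV nV'] VW] := uW x.
  have [U [BU Ux] UV] := Bnbhs x _ (filterI nV nV').
  exists U; first exact: open_nbhs_nbhs (conj (Bo _ BU) Ux).
  exists [:: exist _ U BU]; split=> [y Uy|]; first by exists (exist _ U BU) =>
    //; left.
  by move=> [y z] [_ [<-|//]] /= [/UV[Vy _] /UV[_ Vz]]; exact: VW.
Qed.

(** Distinct stages of the derivation are separated by basic open sets, so the
   stages at which the derivatives for some entourage are nonempty inject into
   the finite sequences of basic open sets: one set for the stage, the others
   for the entourage. *)
Lemma rank_embeds_basis (X : topologicalType) (f : X -> X) (B : set (set X))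
    (A : Type) (g : A -> ord) :
  compact (@setT X) -> basis B -> elt (beta f) infty ->
  (forall u, exists W, uniformity W /\ iter_derived f W setT (g u) !=set0) ->
  (forall u v, ole (g u) (g v) -> ole (g v) (g u) -> u = v) ->
  exists h : A -> seq {U : set X | B U}, injective h.
Proof.
move=> cX Bb fb gne ginj; have [Bo Bnbhs] := Bb.
pose ent (s : seq {U : set X | B U}) :=
  [set p : X * X | exists2 U, List.In U s & sval U p.1 /\ sval U p.2].
have /choice[h Hh] : forall u, exists t : {U : set X | B U} * seq {U : set X |
  B U},
    (sval t.1 `&` iter_derived f (ent t.2) setT (g u) !=set0) /\
    sval t.1 `&` iter_derived f (ent t.2) setT (oSucc (g u)) = set0.
  move=> u; have [W [uW [y Dy]]] := gne u.
  have [s [sT sW]] := uniformity_basis cX Bb uW.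
  have us : uniformity (ent s).
    move=> x; have [U Us Ux] := sT x.
    have nU := open_nbhs_nbhs (conj (Bo _ (svalP U)) Ux).
    by exists (sval U, sval U) => // p [] ? ?; exists U.
  have [|z Dz nDz] := @bounded_shrinks _ _ (ent s) (g u) fb us.
    by exists y; exact: (iter_derived_anti sW).
  have [V [oV Vz HV]] : exists V, [/\ open V, V z & forall v w,
      (iter_derived f (ent s) setT (g u) `&` V) v ->
      (iter_derived f (ent s) setT (g u) `&` V) w -> ent s (f v, f w)].
    apply: contrapT => nV; apply: nDz; split=> // V oV Vz.
    apply: contrapT => nvw; apply: nV; exists V; split=> // v w Vv Vw.
    by apply: contrapT => nW; apply: nvw; exists v, w.
  have [U [BU Uz] UV] := Bnbhs z _ (open_nbhs_nbhs (conj oV Vz)).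
  exists (exist _ U BU, s); split; first by exists z.
  apply/seteqP; split=> // v [/= /UV Vv [_ /(_ V oV Vv)[a [b [Va Vb]]]]].
  by apply; exact: HV.
exists (fun u => (h u).1 :: (h u).2) => u v [e1 e2].
have key u' v' : (h u').1 = (h v').1 -> (h u').2 = (h v').2 ->
  ole (g u') (g v').
  move=> {}e1 {}e2; have [//|lt] := ole_or_lt (g u') (g v').
  have [[y [Uy Dy]] _] := Hh u'; have [_ nD] := Hh v'.
  suff : set0 y by [].
  rewrite -nD -e1 -e2; split=> //.
  exact: (@iter_derived_le _ _ _ _ (oSucc (g v')) _ lt).
by apply: ginj; apply: key.
Qed.

(** A Hausdorff space with a finite basis is discrete, so the first derivative
   is already empty. *)
Lemma finite_basis_beta (X : topologicalType) (f : X -> X) (B : set (set X)) :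
  hausdorff_space X -> basis B -> finite_set B -> forall c, ~ beta f c.
Proof.
move=> hX [Bo Bnbhs] finB c [W [uW [a [Da ca]]]].
have D1 : iter_derived f W setT (oSucc oZero) !=set0.
  have [y Dy] := Da; exists y.
  by apply: iter_derived_le Dy; apply: ole_lt_trans ca.
have [y [_ /= Hy]] := D1.
pose V := \bigcap_(U in B `&` [set U | U y]) U.
have nV : nbhs y V.
  have [s Bs] := finite_fsetP.1 (finite_setIl [set U | U y] finB).
  rewrite /V Bs; apply: filter_bigI => U sU.
  have : (B `&` [set U | U y]) U by rewrite Bs.
  by case=> BU Uy; exact: open_nbhs_nbhs (conj (Bo _ BU) Uy).
have Vy z : V z -> z = y.
  move=> Vz; apply: hX => S S' nS nS'; exists z; split;
    first exact: nbhs_singleton.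
  by have [U [BU Uy] US] := Bnbhs y _ nS'; apply: US; apply: Vz.
move: nV; rewrite nbhsE => -[N [oN Ny] NV].
have [v [w [[_ /NV/Vy->] [_ /NV/Vy->]]]] := Hy N oN Ny.
by apply; exact: nbhs_singleton (uW (f y)).
Qed.

(** A type [A] larger than the weight cannot inject into the rank, as the stages
   inject into the finite sequences of elements of any basis, hence into any
   infinite basis. *)
Lemma beta_lt_succ_weight (X : topologicalType) (f : X -> X) :
  compact (@setT X) -> hausdorff_space X -> elt (beta f) infty ->
  elt (beta f) (succ_card (weight X)).
Proof.
move=> cX hX fb.
have [[B [Bb finB]]|nfin] := pselect (exists B : set (set X),
  basis B /\ finite_set B).
  exists oZero; split; last by move=> d /(finite_basis_beta hX Bb finB).
  move=> A [a [Aa _]] [g [gA _]]; apply: Aa.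
  by exists g; split=> u; have := gA u I.
have [|b bP] := @derived_rank X (fun h W => h = f /\ uniformity W).
  by move=> _ W a [-> uW]; exact: bounded_shrinks.
exists b; split; last first.
  move=> d [W [uW [a [[y Dy] da]]]]; apply/bP; exists f, W; split=> //;
    exists y.
  exact: iter_derived_le (oltW da) _ Dy.
move=> A [a [Aa wa]] [g [gb ginj]].
have [B Bb [k [ka kinj]]] : exists2 B : set (set X), basis B &
    exists k : set X -> ord, (forall U, B U -> olt (k U) a) /\
    (forall U V, B U -> B V -> ole (k U) (k V) -> ole (k V) (k U) -> U = V).
  apply: contrapT => nB; apply: (@olt_irrefl a); apply: wa => B Bb Bk.
  by apply: nB; exists B => //.
apply: Aa.
have [||h hinj] := rank_embeds_basis cX Bb fb (g := g).
- by move=> u; have /bP[_ [W [[-> uW] D0]]] := gb u I; exists W.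
- by move=> u v; exact: ginj.
have /infiniteP/pcard_leP/injfunPex[e eB e_inj] : infinite_set B.
  by move=> finB; apply: nfin; exists B.
have [|p pinj] := @seq_embeds_infinite _ (fun n => exist B (e n) (eB n I)).
  by move=> m n [emn]; apply: e_inj; rewrite ?inE.
exists (fun u => k (sval (p (h u)))); split=> [u _|u v _ _].
  exact: ka (svalP _).
move=> uv vu; apply/hinj/pinj/eq_sig_hprop => [U|].
  exact: Prop_irrelevance.
exact: kinj (svalP _) (svalP _) uv vu.
Qed.

(** * Definability *)

Lemma tfree_bound L (t : term L) : exists N, forall v, tfree v t -> v < N.
Proof.
elim: t => [u|f ts /choice[N HN]]; first by exists u.+1 => v /= ->.
exists (\sum_i N i) => v [i /HN vN].
by apply: leq_trans vN _; rewrite (bigD1 i) //= leq_addr.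
Qed.

Lemma free_bound L (phi : form L) : exists N, forall v, free v phi -> v < N.
Proof.
elim: phi => [|t u|r ts|p [N HN] q [K HK]|x p [N HN]].
- by exists 0.
- have [N HN] := tfree_bound t; have [K HK] := tfree_bound u.
  exists (N + K) => v [/HN|/HK] vlt; apply: (leq_trans vlt).
    exact: leq_addr.
  exact: leq_addl.
- have /choice[N HN] := fun i => tfree_bound (ts i).
  exists (\sum_i N i) => v [i /HN vN].
  by apply: leq_trans vN _; rewrite (bigD1 i) //= leq_addr.
- exists (N + K) => v [/HN|/HK] vlt; apply: (leq_trans vlt).
    exact: leq_addr.
  exact: leq_addl.
- by exists N => v [_ /HN].
Qed.

Lemma eval_ext L (M : structure L) (s s' : nat -> M) (t : term L) :
  (forall v, tfree v t -> s v = s' v) -> Defs.eval s t = Defs.eval s' t.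
Proof.
elim: t => [v|f ts IH] /= H; first exact: H.
by congr fint; apply/funext => i; apply: IH => v Hv; apply: H; exists i.
Qed.

Lemma sat_ext L (M : structure L) (s s' : nat -> M) (phi : form L) :
  (forall v, free v phi -> s v = s' v) -> sat s phi <-> sat s' phi.
Proof.
elim: phi s s' => [|t u|r ts|p IHp q IHq|x p IH] s s' //= H.
- rewrite (@eval_ext _ _ s s' t) ?(@eval_ext _ _ s s' u) // => v Hv; apply: H.
    by right.
  by left.
- suff -> : (fun i => Defs.eval s (ts i)) = (fun i =>
  Defs.eval s' (ts i)) by [].
  by apply/funext => i; apply: eval_ext => v Hv; apply: H; exists i.
- have Ep := IHp s s' (fun v Hv => H v (or_introl Hv)).
  have Eq := IHq s s' (fun v Hv => H v (or_intror Hv)).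
  by split=> pq /Ep/pq/Eq.
- have E a : sat (upd s x a) p <-> sat (upd s' x a) p.
    by apply: IH => v Hv; rewrite /upd; case: eqP => // vx; apply: H.
  by split=> sp a; apply/E.
Qed.

Fixpoint trename L (rho : nat -> nat) (t : term L) : term L :=
  match t with
  | tvar v => tvar (rho v)
  | tapp f ts => tapp (fun i => trename rho (ts i))
  end.

Lemma eval_rename L (M : structure L) rho (s : nat -> M) (t : term L) :
  Defs.eval s (trename rho t) = Defs.eval (s \o rho) t.
Proof.
elim: t => [//|f ts IH] /=; congr fint.
by apply/funext => i; exact: IH.
Qed.

(** Predicates on assignments that are uniformly definable in all structures;
   reasoning with them replaces the syntax of substitution. *)
Definition definable L (P : forall M : structure L, (nat -> M) -> Prop) :=
  exists phi : form L, forall (M : structure L) (s : nat -> M),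
    sat s phi <-> P M s.

Section Definable.
Variable L : language.
Implicit Types P Q : forall M : structure L, (nat -> M) -> Prop.

Lemma definable_sat (phi : form L) : definable (fun M s => sat s phi).
Proof. by exists phi. Qed.

Lemma definable_iff P Q :
  (forall M s, P M s <-> Q M s) -> definable P -> definable Q.
Proof.
move=> PQ [phi H]; exists phi => M s.
exact: iff_trans (H M s) (PQ M s).
Qed.

Lemma definableN P : definable P -> definable (fun M s => ~ P M s).
Proof.
by move=> [phi H]; exists (fneg phi) => M s /=; split=> nP /H.
Qed.

Lemma definableI P Q :
  definable P -> definable Q -> definable (fun M s => P M s /\ Q M s).
Proof.
move=> [phi Hphi] [psi Hpsi]; exists (fneg (fimp phi (fneg psi))) => M s /=.
split=> [H|[/Hphi p /Hpsi q]]; last exact.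
by split; apply: contrapT => n; apply: H => /Hphi p /Hpsi q.
Qed.

Lemma definable_iff_const P (b : Prop) :
  definable P -> definable (fun M s => P M s <-> b).
Proof.
move=> dP; have [Hb|nb] := pselect b.
  by apply: definable_iff dP => M s; split=> // -[_]; apply.
apply: definable_iff (definableN dP) => M s; split=> [nP|[H _] /H//].
by split=> // /nP.
Qed.

Lemma finite_set_seq (I : Type) (D : set I) :
  finite_set D -> exists l : seq I, forall i, D i <-> List.In i l.
Proof.
move=> /(@finite_seqP {classic I})[s sE]; exists s => i.
rewrite sE /=; elim: s {sE} => [//|j s IH] /=.
rewrite inE; split=> [/orP[/eqP->|/IH]|[->|/IH->]]; rewrite ?eqxx ?orbT //.
  by left.
by right.
Qed.

Lemma definable_forall (I : Type) (D : set I)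
    (P : I -> forall M : structure L, (nat -> M) -> Prop) :
  finite_set D -> (forall i, D i -> definable (P i)) ->
  definable (fun M s => forall i, D i -> P i M s).
Proof.
move=> /finite_set_seq[l Dl] dP.
have {dP} : forall i, List.In i l -> definable (P i) by move=> i /Dl/dP.
move=> dP; suff : definable (fun M s => forall i, List.In i l -> P i M s).
  by move=> dl; apply: (definable_iff _ dl) => M s; split=> H i /Dl; exact: H.
elim: l dP {Dl} => [|i l IH] dP; first by exists (fneg fbot) => M s /=; split.
apply: definable_iff (definableI (dP i (or_introl erefl))
  (IH (fun j lj => dP j (or_intror lj)))) => M s.
split=> [[Pi Pl] j [<-//|/Pl//]|H]; split; first exact/H/or_introl.
by move=> j lj; apply: H; right.
Qed.

Lemma definable_rename rho P :
  definable P -> definable (fun M s => P M (s \o rho)).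
Proof.
move=> [phi H]; apply: (@definable_iff (fun M s => sat (s \o rho) phi)).
  by move=> M s; exact: H.
elim: phi rho {P H} => [|t u|r ts|p IHp q IHq|x p IH] rho.
- by exists fbot.
- by exists (feq (trename rho t) (trename rho u)) => M s /=;
  rewrite !eval_rename.
- exists (Defs.frel (fun i => trename rho (ts i))) => M s /=.
  suff -> : (fun i => Defs.eval s (trename rho (ts i))) =
    (fun i => Defs.eval (s \o rho) (ts i)) by [].
  by apply/funext => i; rewrite eval_rename.
- have [p' Hp] := IHp rho; have [q' Hq] := IHq rho.
  by exists (fimp p' q') => M s /=; split=> H /Hp/H/Hq.
- have [N HN] := free_bound p.
  (* a variable that is not the image of a free variable of [p] *)
  pose w := (\sum_(v < N) rho v).+1.
  have [p' Hp] := IH (upd rho x w).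
  exists (fall w p') => M s /=.
  have E a : sat (upd s w a) p' <-> sat (upd (s \o rho) x a) p.
    apply: iff_trans (Hp _ _) _; apply: sat_ext => v /HN vN /=.
    rewrite /upd; case: (v =P x) => [_|vx]; first by rewrite eqxx.
    case: eqP => // vw; exfalso.
    have : rho v < w by rewrite ltnS (bigD1 (Ordinal vN)) //= leq_addr.
    by rewrite vw ltnn.
  by split=> H a; apply/E; exact: H.
Qed.

Lemma split_assignment_cons (A : Type) y ys (a s : nat -> A) :
  split_assignment (y :: ys) a s = upd (split_assignment ys a s) y (a y).
Proof.
apply/funext => v; rewrite /split_assignment /upd inE.
by case: eqP => // ->.
Qed.

Lemma split_assignment1 (A : Type) x (a s : nat -> A) :
  split_assignment [:: x] a s = upd s x (a x).
Proof. exact: split_assignment_cons. Qed.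

Lemma exists_form (phi : form L) (ys : seq nat) :
  exists psi : form L, (forall (M : structure L) (s : nat -> M),
      sat s psi <-> exists a, sat (split_assignment ys a s) phi) /\
    (forall v, free v psi -> free v phi /\ v \notin ys).
Proof.
elim: ys phi => [|y ys IH] phi.
  by exists phi; split=> // M s; split=> [sp|[]//]; exists s.
have [psi [Hpsi Fpsi]] := IH (fneg (fall y (fneg phi))).
exists psi; split=> [M s|v /Fpsi/=]; last first.
  case=> [[[/eqP vy [fv|//]]|//] nys].
  by rewrite inE negb_or vy nys.
apply: iff_trans (Hpsi M s) _ => /=; split=> [[a Ha]|[a Ha]].
  have [c Hc] : exists c, sat (upd (split_assignment ys a s) y c) phi.
    by apply: contrapT => n; apply: Ha => c Hc; apply: n; exists c.
  exists (upd a y c); apply: (iffLR (sat_ext _)) Hc => v _.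
  rewrite /split_assignment /upd inE; case: eqP => //= vy.
by exists a => /(_ (a y)); rewrite -split_assignment_cons.
Qed.

Lemma definable_exists (ys : seq nat) P : definable P ->
  definable (fun M s => exists a, P M (split_assignment ys a s)).
Proof.
move=> [phi Hphi]; have [psi [Hpsi _]] := exists_form phi ys.
exists psi => M s; apply: iff_trans (Hpsi M s) _.
by split=> -[a /Hphi Ha]; exists a.
Qed.

(** The existential closure of the condition is a sentence, which the theory
   decides. *)
Lemma definable_transfer (T : set (form L)) (M N : structure L) P :
  complete_theory T -> models M T -> models N T -> definable P ->
  (exists s, P M s) -> exists s, P N s.
Proof.
move=> [_ _ Tcomplete] MT NT [phi Hphi] [s /Hphi Ms].
have [K HK] := free_bound phi.
have [psi [Hpsi Fpsi]] := exists_form phi (iota 0 K).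
have closed_psi : sentence psi.
  by move=> v /Fpsi[/HK vK]; rewrite mem_iota vK.
have [c0] := carrier_inhabited N.
have [Tpsi|Tnpsi] := Tcomplete psi closed_psi.
  by have /Hpsi[a Ha] := Tpsi N NT (fun=> c0); eexists; apply/Hphi; exact: Ha.
case: (Tnpsi M MT s); apply/Hpsi; exists s.
suff -> : split_assignment (iota 0 K) s s = s by [].
by apply/funext => v; rewrite /split_assignment if_same.
Qed.
End Definable.

(** * Saturation *)

Lemma filter_bigcap_finite (T I : Type) (F : set_system T) (D : set I)
    (f : I -> set T) :
  Filter F -> finite_set D -> (forall i, D i -> F (f i)) ->
  F (\bigcap_(i in D) f i).
Proof.
move=> FF /finite_set_seq[l Dl] Ff.
have {Ff} : forall i, List.In i l -> F (f i) by move=> i /Dl/Ff.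
move=> Ff; suff : F [set x | forall i, List.In i l -> f i x].
  by apply: filterS => x Hx i /Dl/Hx.
elim: l Ff {Dl} => [|i l IH] Ff; first by apply: filterS filterT => x _ i [].
apply: filterS (filterI (Ff i (or_introl erefl))
  (IH (fun j lj => Ff j (or_intror lj)))).
by move=> x [fi fl] j [<-//|/fl].
Qed.

Lemma fip_ultra (T I : Type) (D : set I) (f : I -> set T) :
  (forall E, finite_set E -> E `<=` D -> \bigcap_(i in E) f i !=set0) ->
  exists2 U : set_system T, UltraFilter U & forall i, D i -> U (f i).
Proof.
move=> fip.
pose F := [set A : set T | exists E, [/\ finite_set E, E `<=` D &
  \bigcap_(i in E) f i `<=` A]].
have FF : ProperFilter F.
  split.
    by move=> [E [finE ED sub0]]; have [x /sub0[]] := fip E finE ED.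
  split.
  - by exists set0; split=> // i [].
  - move=> A B [E [finE ED EA]] [E' [finE' ED' EB]]; exists (E `|` E'); split.
    + by rewrite finite_setU.
    + by move=> i [/ED|/ED'].
    + by move=> x Hx; split; [apply: EA|apply: EB] => i Ei; apply: Hx;
      [left|right].
  - by move=> A B AB [E [finE ED EA]]; exists E; split=> //;
    exact: subset_trans AB.
have [U [UU FU]] := ultraFilterLemma FF.
exists U => // i Di; apply: FU; exists [set i]; split=> //.
  by move=> _ ->.
by move=> x; apply.
Qed.

Section Monster.
Variables (L : language) (C : structure L).
Hypothesis hM : monster C.

Lemma countable_range_lt (K : Type) (s : nat -> C) :
  card_lt [set: form L] [set: K] -> card_lt (range s) [set: K].
Proof.
apply: contraNN => Ks; apply: (card_le_trans Ks).
apply: (card_le_trans (card_image_le s setT)).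
have /injfunPex[f] : exists2 f : nat -> form L,
  set_fun setT setT f & set_inj setT f.
  by exists (fun n => feq (tvar n) (tvar n)) => // m n _ _ [].
exact: inj_card_le f.
Qed.

(** Saturation applies to complete types; a finitely satisfiable set of formulas
   is completed by an ultrafilter on the structure. *)
Lemma monster_realize (x : nat) (s : nat -> C) (P : set (pform C)) :
  P `<=` params_in x (range s) ->
  (forall F, finite_set F -> F `<=` P -> exists a, F `<=` psat x a) ->
  exists a, P `<=` psat x a.
Proof.
move=> Ppar Pfin; have [K [LK satK _]] := hM.
have [|U UU PU] := @fip_ultra C _ P (fun q => [set a | psat x a q]).
  by move=> E finE EP; have [a Ea] := Pfin E finE EP; exists a => q /Ea.
pose p : set (pform C) :=
  [set q | params_in x (range s) q /\ U [set a | psat x a q]].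
have cp : complete_type x (range s) p.
  split; first by move=> q [].
    move=> F finF Fp.
    have : U (\bigcap_(q in F) [set a | psat x a q]).
      by apply: filter_bigcap_finite => // q /Fp[].
    by move=> /filter_ex[a aF]; exists a => q /aF.
  move=> q qpar; have [Uq|Uq] := in_ultra_setVsetC [set a | psat x a q] UU.
    by left.
  by right; split=> //= v [/qpar//|].
have [a ap] := satK _ (countable_range_lt s LK) _ _ cp.
by exists a => q Pq; apply: ap; split; [exact: Ppar|exact: PU].
Qed.

(** Countably many variables are realized one at a time, each step preserving
   the agreement of the values found so far with an ultrafilter of assignments
   on the formulas about them. *)
Lemma monster_realize_assignment (I : Type) (D : set I)
    (P : I -> forall M : structure L, (nat -> M) -> Prop) :
  (forall i, D i -> definable (P i)) ->
  (forall E, finite_set E -> E `<=` D ->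
     \bigcap_(i in E) [set s | P i C s] !=set0) ->
  exists s, forall i, D i -> P i C s.
Proof.
move=> Ddef /fip_ultra[U UU DU].
(* [inv n s]: the first [n] values of [s] satisfy the formulas on them that hold
   for [U]-almost all assignments *)
pose agree n (t t' : nat -> C) := forall v, v < n -> t v = t' v.
pose supp n (phi : form L) := forall t t' : nat -> C,
  agree n t t' -> sat t phi -> sat t' phi.
pose inv n (s : nat -> C) := forall phi, supp n phi ->
  U [set t | sat t phi] -> sat s phi.
have Uneg (phi : form L) :
    ~ U [set t : nat -> C | sat t phi] -> U [set t : nat ->
      C | sat t (fneg phi)].
  by case: (in_ultra_setVsetC [set t : nat -> C | sat t phi] UU).
have step n s : inv n s -> exists a, inv n.+1 (upd s n a).
  move=> invn.
  pose Q : set (pform C) := [set q | [/\ q.2 = s, supp n.+1 q.1 &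
    U [set t : nat -> C | sat t q.1]]].
  have [||a Qa] := @monster_realize n s Q.
  - by move=> [phi _] [/= -> _ _] v _ _; exists v.
  - move=> F finF FQ.
    have [psi Hpsi] := @definable_exists L [:: n]
      (fun M t => forall q, F q -> sat t q.1)
      (definable_forall finF (fun q _ => definable_sat q.1)).
    have /Hpsi[a Ha] : sat s psi.
      apply: invn.
        move=> t t' tt' /Hpsi[a Ha]; apply/Hpsi; exists a => q Fq.
        have [_ supq _] := FQ q Fq; apply: supq (Ha q Fq) => v.
        rewrite ltnS leq_eqVlt /split_assignment inE; case: eqP => //= _.
        exact: tt'.
      have : U (\bigcap_(q in F) [set t | sat t q.1]).
        by apply: filter_bigcap_finite => // q /FQ[].
      apply: filterS => t Ht; apply/Hpsi; exists t => q Fq.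
      have -> : split_assignment [:: n] t t = t.
        by apply/funext => v; rewrite /split_assignment if_same.
      exact: Ht.
    exists (a n) => q Fq; have [qs _ _] := FQ q Fq.
    by rewrite /psat qs -split_assignment1; exact: Ha.
  exists a => phi sphi Uphi; exact: (Qa (phi, s)).
have [c0] := carrier_inhabited C.
have inv0 : inv 0 (fun=> c0).
  by move=> phi sphi /filter_ex[t /= tphi]; exact: sphi tphi.
have /choice[next Hnext] : forall p : nat * (nat -> C), exists a,
    inv p.1 p.2 -> inv p.1.+1 (upd p.2 p.1 a).
  move=> [n s]; have [/step[a Ha]|ni] := pselect (inv n s); first by exists a.
  by exists c0.
pose st := fix st n := if n is m.+1 then upd (st m) m (next (m,
  st m)) else fun=> c0.
have stP n : inv n (st n).
  by elim: n => [//|n IH]; exact: (Hnext (n, st n)).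
have st_stable n m : agree n (st n) (st (n + m)).
  elim: m => [|m IH] v vn; first by rewrite addn0.
  rewrite IH // addnS /= /upd; case: eqP => // vE.
  by move: vn; rewrite vE ltnNge leq_addr.
exists (fun v => st v.+1 v) => i Di; have [phi Hphi] := Ddef i Di.
have [N HN] := free_bound phi.
have supN : supp N phi.
  by move=> t t' tt'; apply: (iffLR (sat_ext _)) => v /HN; exact: tt'.
apply/Hphi; apply: (supN (st N)).
  by move=> v vN; rewrite -(subnKC vN); symmetry; apply: st_stable.
apply: stP => //; apply: filterS (DU i Di) => t.
exact: iffRL (Hphi C t).
Qed.

(** The map sending [b v] to [c v] is well defined, as formulas express the
   equality of two variables; it is elementary on a countable set. *)
Lemma monster_conjugate (b c : nat -> C) :
  (forall phi : form L, sat b phi -> sat c phi) ->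
  exists g : aut C, c = g \o b.
Proof.
move=> bc.
have {}bc phi : sat b phi <-> sat c phi.
  by split; [exact: bc|move=> Hc; apply: contrapT => nb;
    exact: (bc (fneg phi))].
have [K [LK _ homK]] := hM.
have /choice[h Hh] : forall x, exists y, forall v, x = b v -> y = c v.
  move=> x; have [[v ->]|nx] := pselect (exists v, x = b v); last first.
    by exists x => v xv; case: nx; exists v.
  exists (c v) => w bvw; exact: (iffLR (bc (feq (tvar v) (tvar w)))).
have [|g Hg] := homK (range b) h (countable_range_lt b LK).
  move=> phi s sA.
  have /choice[rho Hrho] : forall v, exists w, free v phi -> s v = b w.
    move=> v; have [/sA[w _ <-]|nf] := pselect (free v phi); first by exists w.
    by exists 0.
  have [psi Hpsi] := definable_rename rho (definable_sat phi).
  have Es : sat s phi <-> sat b psi.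
    by apply: iff_trans (iff_sym (Hpsi _ _)); apply: sat_ext => v /Hrho.
  have Eh : sat (h \o s) phi <-> sat c psi.
    apply: iff_trans (iff_sym (Hpsi _ _)); apply: sat_ext => v /Hrho /= svE.
    exact: Hh.
  exact: iff_trans Es (iff_trans (bc psi) (iff_sym Eh)).
exists g; apply/funext => v /=; rewrite Hg; last by exists v.
by symmetry; apply: Hh.
Qed.
End Monster.

(** * Independent sequences *)

(** Countably many assignments are coded by one: the variables
   [pickle (k.+1, v)] form row [k], and the variables [pickle (0, v)] are kept
   free for quantification. *)
Definition row (A : Type) (s : nat -> A) (k : nat) : nat -> A :=
  fun v => s (pickle (k.+1, v)).

Definition join_rows (A : Type) (c : nat -> nat -> A) : nat -> A :=
  fun w => if @unpickle (nat * nat)%type w is Some (k.+1, v) then c k v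
           else c 0 0.

Lemma row_join (A : Type) (c : nat -> nat -> A) k : row (join_rows c) k = c k.
Proof. by apply/funext => v; rewrite /row /join_rows pickleK. Qed.

(** The objects are the values of the variables [ys], and the parameters those of
   the others: the instances of [phi] at the objects shatter the family [c]. *)
Definition independent L (M : structure L) (phi : form L) (ys : seq nat)
    (I : finType) (c : I -> nat -> M) : Prop :=
  forall J : {set I}, exists a, forall i,
    sat (split_assignment ys a (c i)) phi <-> i \in J.

Lemma definable_pattern L (phi : form L) (ys : seq nat) (I : finType)
    (k : I -> nat) (J : {set I}) :
  definable (fun (M : structure L) s => exists a, forall i,
    sat (split_assignment ys a (row s (k i))) phi <-> i \in J).
Proof.
pose rho i v : nat := if v \in ys then pickle (0, v) else pickle ((k i).+1, v).
have dQ : definable (fun (M : structure L) s => forall i, setT i ->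
    sat (s \o rho i) phi <-> i \in J).
  apply: definable_forall => // i _; apply: definable_iff_const.
  exact: (definable_rename (rho i) (definable_sat phi)).
pose ys' : seq nat := [seq pickle (0, v) | v <- ys].
apply: definable_iff (definable_exists ys' dQ) => M s.
have split_rho a i : split_assignment ys' a s \o rho i =
    split_assignment ys (fun v => a (pickle (0, v))) (row s (k i)).
  apply/funext => v; rewrite /split_assignment /rho /row /=.
  case: (boolP (v \in ys)) => vys.
    by rewrite (map_f (fun v => pickle (0, v)) vys).
  by case: ifP => // /mapP[w _ /(pcan_inj pickleK)].
split=> -[a Ha].
  by exists (fun v => a (pickle (0, v))) => i; rewrite -split_rho; exact: Ha.
pose a' (w : nat) := if @unpickle (nat * nat)%type w is Some (_,
  v) then a v else a 0.
have a'E : (fun v => a' (pickle (0, v))) = a.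
  by apply/funext => v; rewrite /a' pickleK.
by exists a' => i _; rewrite split_rho a'E; exact: Ha.
Qed.

Section Rich.
Variables (L : language) (C : structure L) (phi : form L) (ys : seq nat).

Lemma independent_sub (I I' : finType) (c : I -> nat -> C) (e : I' -> I) :
  injective e -> independent phi ys c -> independent phi ys (c \o e).
Proof.
move=> e_inj ic J; have [a Ha] := ic (e @: J).
by exists a => i; rewrite -(mem_imset _ _ e_inj); exact: Ha.
Qed.

Definition rich (S : set (nat -> C)) : Prop :=
  forall n, exists2 c : 'I_n -> nat -> C,
    forall i, S (c i) & independent phi ys c.

Lemma richS (S S' : set (nat -> C)) : S `<=` S' -> rich S -> rich S'.
Proof. by move=> SS' rS n; have [c Sc ic] := rS n; exists c => // i;
  exact: SS'. Qed.

Lemma rich_subset (S : set (nat -> C)) n N (c : 'I_N -> nat -> C)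
    (X : {set 'I_N}) :
  independent phi ys c -> (forall i, i \in X -> S (c i)) -> n <= #|X| ->
  exists2 c' : 'I_n -> nat -> C, forall i, S (c' i) & independent phi ys c'.
Proof.
move=> ic XS nX; exists (c \o (@enum_val _ (mem X) \o widen_ord nX)).
  by move=> i /=; apply: XS; exact: enum_valP.
apply: independent_sub => // i j /= /enum_val_inj/(congr1 val) /= ij.
exact: val_inj.
Qed.

(** Partition regularity: one of the two sets contains its share of the members
   of a long independent family, and they still form an independent family. *)
Lemma richU (S S' : set (nat -> C)) : rich (S `|` S') -> rich S \/ rich S'.
Proof.
move=> rU; apply: contrapT => /not_orP[/existsNP[n nS] /existsNP[n' nS']].
have [c Uc ic] := rU (n + n').
pose X : {set 'I_(n + n')} := finset (fun i => `[< S (c i) >]).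
have XS i : i \in X -> S (c i) by rewrite inE => /asboolP.
have XS' i : i \in ~: X -> S' (c i).
  by rewrite !inE => /asboolPn nSi; case: (Uc i).
case: (leqP n #|X|) => [nX|Xn]; first exact: nS (rich_subset ic XS nX).
apply: nS' (rich_subset ic XS' _).
have := cardsC X; rewrite card_ord => E.
by rewrite -(leq_add2l #|X|) E leq_add2r ltnW.
Qed.

(** By partition regularity the sets that are not rich form an ideal. *)
Lemma rich_ultra : rich setT -> exists2 U, UltraFilter U & U `<=` rich.
Proof.
move=> rT.
pose F := [set S : set (nat -> C) | ~ rich (~` S)].
have FF : ProperFilter F.
  split; first by rewrite /F /= setC0.
  split.
  - by rewrite /F /= setCT => /(_ 1)[c /(_ ord0)].
  - by move=> A B FA FB; rewrite /F /= setCI => /richU[].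
  - by move=> A B AB FA; rewrite /F /= => /(richS (subsetC AB)).
have [U [UU FU]] := ultraFilterLemma FF; exists U => // S US.
apply: contrapT => nrS.
have UnS : U (~` S) by apply: FU; rewrite /F /= setCK.
by have [s []] := filter_ex (filterI US UnS).
Qed.
End Rich.

Lemma finite_set_bound (I : Type) (E : set I) (f : I -> nat) :
  finite_set E -> exists N, forall i, E i -> f i <= N.
Proof.
move=> /finite_set_seq[l El].
suff [N HN] : exists N, forall i, List.In i l -> f i <= N.
  by exists N => i /El/HN.
elim: l {E El} => [|j l [N HN]]; first by exists 0.
exists (f j + N) => i /= [<-|/HN iN]; first exact: leq_addr.
exact: leq_trans iN (leq_addl _ _).
Qed.

(** Compactness yields an infinite independent sequence.  Its members can be
   required to have the same type, since every finite part of a type given by an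
   ultrafilter of rich sets is realized by all members of arbitrarily long
   independent families. *)
Lemma rich_sequence L (C : structure L) (phi : form L) (ys : seq nat) :
  monster C -> rich phi ys (@setT (nat -> C)) ->
  exists c : nat -> nat -> C,
    (forall n, independent phi ys (fun i : 'I_n => c i)) /\
    (forall k psi, sat (c 0) psi -> sat (c k) psi).
Proof.
move=> hM /rich_ultra[U UU Urich].
pose D : set ({n & {set 'I_n}} + form L * nat) := [set x |
  if x is inr (psi, _) then U [set s : nat -> C | sat s psi] else True].
pose P (x : {n & {set 'I_n}} + form L * nat) (M : structure L) (s : nat -> M) :=
  match x with
  | inl (existT n J) => exists a, forall i : 'I_n,
      sat (split_assignment ys a (row s i)) phi <-> i \in J
  | inr (psi, k) => sat (row s k) psi
  end.
have [|E finE ED|s Hs] := @monster_realize_assignment _ _ hM _ D P.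
- move=> [[n J]|[psi k]] _; first exact: definable_pattern.
  exact: (definable_rename (fun v => pickle (k.+1, v)) (definable_sat psi)).
- have [N HN] := finite_set_bound
    (fun x => if x is inl (existT n _) then n else 0) finE.
  have UE : U (\bigcap_(x in E)
      [set s : nat -> C | if x is inr (psi, _) then sat s psi else True]).
    apply: filter_bigcap_finite => // -[[n J]|[psi k]] Ex.
      by apply: filterS filterT.
    exact: ED Ex.
  have [c Ec ic] := Urich _ UE N.+1.
  exists (join_rows (fun k => c (inord k))) => -[[n J]|[psi k]] Ex /=;
    last first.
    by rewrite row_join; exact: (Ec (inord k) _ Ex).
  have nN : n <= N.+1 := leqW (HN _ Ex).
  have e_inj : injective (widen_ord nN).
    by move=> i j /(congr1 val) /= /val_inj.
  have [a Ha] := independent_sub e_inj ic J; exists a => i.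
  rewrite row_join; suff -> : inord i = widen_ord nN i by exact: Ha.
  by apply: val_inj; rewrite /= inordK // (leq_trans (ltn_ord i)).
exists (row s); split.
  by move=> n J; have := Hs (inl (existT _ n J)) I.
move=> k psi s0; have [Upsi|Unpsi] := in_ultra_setVsetC [set s | sat s psi] UU.
  exact: (Hs (inr (psi, k)) Upsi).
by have /= := Hs (inr (fneg psi, 0)) Unpsi.
Qed.

Lemma independent_realize L (C : structure L) (phi : form L) (x : nat)
    (c : nat -> nat -> C) :
  monster C -> (forall n, independent phi [:: x] (fun i : 'I_n => c i)) ->
  forall J : set nat, exists a, forall i, sat (upd (c i) x a) phi <-> J i.
Proof.
move=> hM ic J.
pose q i : pform C := (if `[< J i >] then phi else fneg phi, c i).
have [||a Ha] := @monster_realize _ _ hM x (join_rows c) (range q).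
- by move=> _ [i _ <-] v _ _; exists (pickle (i.+1, v)) => //=;
    rewrite /join_rows pickleK.
- move=> F finF Fq.
  have /choice[k Hk] : forall r, exists i, F r -> q i = r.
    by move=> r; have [/Fq[i _ <-]|nF] := pselect (F r); [exists i|exists 0].
  have [N HN] := finite_set_bound k finF.
  have [a Ha] := ic N.+1 (finset (fun i : 'I_N.+1 => `[< J i >])).
  exists (a x) => r Fr; have kN : k r < N.+1 by rewrite ltnS HN.
  suff : psat x (a x) (q (k r)) by rewrite Hk.
  have := Ha (Ordinal kN); rewrite split_assignment1 inE /psat /q /=.
  by case: asboolP => Ji [H1 H2]; [exact: H2|move=> /H1].
exists a => i; have := Ha (q i) (imageT _ _); rewrite /psat /q /=.
case: asboolP => Ji Hs; split=> //. by move=> /Hs[].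
Qed.

(** The roles of objects and parameters are exchanged: the independent parameters
   are substituted for the tuple [xs], and one object for each set of them is
   substituted for [x]. *)
Lemma rich_has_IP L (T : set (form L)) (C : structure L) (phi : form L)
    (x : nat) :
  models C T -> monster C -> rich phi [:: x] (@setT (nat -> C)) ->
  exists xs, has_IP T phi xs.
Proof.
move=> hC hM /(rich_sequence hM)[c [ic _]].
have /choice[b Hb] := independent_realize hM ic.
have [N HN] := free_bound phi.
exists [seq v <- iota 0 N | v != x], C; split=> //.
exists c, (fun J _ => b J) => i J; apply: iff_trans (Hb J i).
apply: sat_ext => v /HN vN; rewrite /split_assignment mem_filter mem_iota vN
  /upd.
by case: eqP.
Qed.

Lemma has_IP_rich L (T : set (form L)) (C : structure L) (phi : form L) xs :
  complete_theory T -> models C T -> has_IP T phi xs ->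
  exists ys, rich phi ys (@setT (nat -> C)).
Proof.
move=> hT hC [M [hM [a [b ab]]]].
have [N HN] := free_bound phi.
pose ys := [seq v <- iota 0 N | v \notin xs]; exists ys => n.
have [||s Hs] := @definable_transfer _ T M C (fun M s =>
  forall J : {set 'I_n}, setT J ->
  exists a, forall i : 'I_n,
    sat (split_assignment ys a (row s i)) phi <-> i \in J) hT hM hC.
- by apply: definable_forall => // J _; exact: definable_pattern.
- exists (join_rows a) => J _; exists (b [set k : nat | exists2 j : 'I_n,
  j \in J & k = nat_of_ord j]) => i.
  rewrite row_join.
  apply: (@iff_trans _ (exists2 j : 'I_n, j \in J & nat_of_ord i = nat_of_ord
    j)); last first.
    by split=> [[j jJ /val_inj->]|iJ]; [|exists i].
  apply: (iff_trans _ (ab i [set k : nat | exists2 j : 'I_n,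
    j \in J & k = nat_of_ord j])).
  apply: sat_ext => v /HN vN.
  by rewrite /split_assignment mem_filter mem_iota vN andbT; case: (v \in xs).
by exists (fun i => row s i) => // J; exact: Hs.
Qed.

(** * Shattering *)

Section Shattering.
Import mathcomp.boot.finset.
Local Open Scope set_scope.

Definition shatters (T : finType) (F : {set {set T}}) (A : {set T}) : bool :=
  [forall (B : {set T} | B \subset A), exists S in F, S :&: A == B].

(** Pajor's inequality.  For a point [x], the members not containing [x], and the
   traces on the complement of [x] of those containing it, satisfy the inequality
   by induction, and a set shattered by both families remains shattered with [x]
   added. *)
Lemma leq_card_shattered (T : finType) (F : {set {set T}}) :
  #|F| <= #|[set A | shatters F A]|.
Proof.
suff H n (X : {set T}) (G : {set {set T}}) : #|X| = n ->
    (forall S, S \in G -> S \subset X) -> #|G| <= #|[set A | shatters G A]|.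
  by apply: (H _ setT) => // S _; exact: subsetT.
elim: n X G => [|n IH] X G => [/cards0_eq->|Xn] GX.
  have G1 S : S \in G -> S = set0 by move=> /GX; rewrite subset0 => /eqP.
  have [->|[S GS]] := set_0Vmem G; first by rewrite cards0.
  apply: (@leq_trans 1).
    by apply/card_le1_eqP => S1 S2 /G1-> /G1->.
  rewrite card_gt0; apply/set0Pn; exists set0; rewrite inE.
  apply/forall_inP => B; rewrite subset0 => /eqP->.
  by apply/exists_inP; exists S; rewrite // setI0.
have [x Xx] : exists x, x \in X by apply/set0Pn; rewrite -card_gt0 Xn.
pose G0 := [set S in G | x \notin S].
pose G1 := [set S : {set T} | (x \notin S) && (x |: S \in G)].
have cardG : #|G| = #|G0| + #|G1|.
  rewrite -(cardsID [set S : {set T} | x \notin S] G); congr addn.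
    by apply: eq_card => S; rewrite !inE.
  rewrite -(@card_in_imset _ _ (fun S => x |: S) G1).
    apply: eq_card => S; rewrite !inE negbK; apply/idP/imsetP.
      move=> /andP[xS GS]; exists (S :\ x); last by rewrite setD1K.
      by rewrite !inE eqxx setD1K.
    by move=> [S']; rewrite !inE => /andP[_ GS'] ->; rewrite setU11.
  move=> S S'; rewrite !inE => /andP[xS _] /andP[xS' _] E.
  by rewrite -(setU1K xS) -(setU1K xS') E.
have cX : #|X :\ x| = n by move: Xn; rewrite (cardsD1 x) Xx => -[].
have sub0 S : S \in G0 -> S \subset X :\ x.
  by rewrite inE => /andP[/GX SX xS]; rewrite subsetD1 SX.
have sub1 S : S \in G1 -> S \subset X :\ x.
  rewrite inE => /andP[xS /GX SX]; rewrite subsetD1 xS andbT.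
  exact: fintype.subset_trans (subsetUr _ _) SX.
have notin (H : {set {set T}}) A :
    (forall S, S \in H -> x \notin S) -> shatters H A -> x \notin A.
  move=> Hx /forall_inP/(_ A (subxx _))/exists_inP[S /Hx xS /eqP SA].
  by rewrite -SA inE negb_and xS.
have notin0 A : shatters G0 A -> x \notin A.
  by apply: (notin G0) => S; rewrite inE => /andP[].
have notin1 A : shatters G1 A -> x \notin A.
  by apply: (notin G1) => S; rewrite inE => /andP[].
pose sh0 := [set A | shatters G0 A]; pose sh1 := [set A | shatters G1 A].
have G0G A : shatters G0 A -> shatters G A.
  move=> /forall_inP H; apply/forall_inP => B /H/exists_inP[S].
  by rewrite inE => /andP[GS _] SA; apply/exists_inP; exists S.
have G1x (S A : {set T}) : x \notin A -> (x |: S) :&: A = S :&: A.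
  move=> xA; apply/setP => z; rewrite !inE; case: eqP => // ->.
  by rewrite (negPf xA) !andbF.
have G1G A : shatters G1 A -> shatters G A.
  move=> sA; have xA := notin1 A sA; move/forall_inP: sA => H.
  apply/forall_inP => B /H/exists_inP[S].
  rewrite inE => /andP[_ GS] SA; apply/exists_inP; exists (x |: S) => //.
  by rewrite G1x.
have GxG A : shatters G0 A -> shatters G1 A -> shatters G (x |: A).
  move=> s0 s1; have xA := notin0 A s0.
  move/forall_inP: s0 => s0; move/forall_inP: s1 => s1.
  apply/forall_inP => B BxA.
  have BA : B :\ x \subset A by rewrite subDset.
  have [xB|xB] := boolP (x \in B); apply/exists_inP.
    have /exists_inP[S] := s1 _ BA; rewrite inE => /andP[_ GS] /eqP SA.
    by exists (x |: S) => //; rewrite -setUIr SA setD1K.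
  have /exists_inP[S] := s0 _ BA; rewrite inE => /andP[GS xS] /eqP SA.
  exists S => //; rewrite setIUr SA (_ : S :&: [set x] = set0); last first.
    by apply/setP => z; rewrite !inE; case: eqP => [->|_];
       rewrite ?(negPf xS) ?andbF.
  rewrite set0U; apply/eqP/setP => z; rewrite !inE; case: eqP => // ->.
  by rewrite (negPf xB).
rewrite cardG (leq_trans (leq_add (IH _ _ cX sub0) (IH _ _ cX sub1))) //.
rewrite -/sh0 -/sh1 -cardsUI.
rewrite -(@card_in_imset _ _ (fun A => x |: A) (sh0 :&: sh1)); last first.
  move=> A A'; rewrite !inE => /andP[/notin0 xA _] /andP[/notin0 xA' _] E.
  by rewrite -(setU1K xA) -(setU1K xA') E.
have disj : (sh0 :|: sh1) :&: [set x |: A | A in sh0 :&: sh1] = set0.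
  apply/setP => A; rewrite !inE; apply/negbTE/negP =>
    /andP[sA /imsetP[A' _ AE]].
  have : x \notin A by case/orP: sA => [/notin0|/notin1].
  by rewrite AE setU11.
rewrite -cardsUI disj cards0 addn0.
apply/subset_leq_card/fintype.subsetP => A; rewrite !inE =>
  /orP[/orP[/G0G|/G1G]//|].
by move=> /imsetP[A']; rewrite !inE => /andP[s0 s1] ->; exact: GxG.
Qed.

Lemma card_small_sets (T : finType) d :
  #|[set A : {set T} | #|A| < d]| <= #|T|.+1 ^ d.
Proof.
rewrite -card_option -[d in _ ^ d]card_ord -card_ffun.
pose range (f : {ffun 'I_d -> option T}) := [set x | Some x \in codom f].
apply: leq_trans (leq_imset_card range _);
  apply/subset_leq_card/fintype.subsetP => A.
rewrite inE => Ad; apply/imsetP.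
exists [ffun i : 'I_d => nth None (map Some (enum A)) i] => //.
apply/setP => x; rewrite inE; apply/idP/codomP => [xA|[i]].
  have ilt : index x (enum A) < #|A| by rewrite cardE index_mem mem_enum.
  exists (Ordinal (ltn_trans ilt Ad)); rewrite ffunE /=.
  by rewrite (nth_map x) ?nth_index ?mem_enum // -cardE.
rewrite ffunE; have [iA|iA] := ltnP i (size (enum A)).
  by rewrite (nth_map x) // => -[->]; rewrite -mem_enum mem_nth.
by rewrite nth_default // size_map.
Qed.

(** All the shattered sets have fewer than [d] elements, and by Pajor's inequality
   they are at least as many as the members of [F]. *)
Lemma sauer_shelah (T : finType) (F : {set {set T}}) d :
  (forall e : 'I_d -> T, injective e ->
     exists J : {set 'I_d}, forall S, S \in F -> exists k,
       (e k \in S) != (k \in J)) ->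
  #|F| <= #|T|.+1 ^ d.
Proof.
move=> H; apply: leq_trans (leq_card_shattered F) _.
apply: leq_trans (card_small_sets T d); apply/subset_leq_card/fintype.subsetP
  => A.
rewrite !inE => /forall_inP sA; rewrite ltnNge; apply/negP => dA.
pose e := @enum_val _ (mem A) \o widen_ord dA.
have e_inj : injective e.
  by move=> i j /enum_val_inj/(congr1 val)/= /val_inj.
have eA k : e k \in A by exact: enum_valP.
have [J HJ] := H e e_inj.
have /sA/exists_inP[S FS /eqP SA] : e @: J \subset A.
  by apply/fintype.subsetP => _ /imsetP[k _ ->].
have [k /negP[]] := HJ S FS; apply/eqP.
by rewrite -(mem_imset _ _ e_inj) -SA inE eA andbT.
Qed.

Lemma exp_beats_poly D : exists n, n.+2 ^ D < 2 ^ n.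
Proof.
have [k Hk] : exists k, k * D + 2 < 2 ^ k.
  pose j := D.*2.+2; exists (j + j); rewrite expnD.
  have jlt : j < 2 ^ j by exact: ltn_expl.
  apply: leq_trans (leq_mul jlt jlt).
  rewrite mulSn mulnS addnA /j; nia.
(* for this [n], both sides are powers of 2 *)
exists (2 ^ k - 2); rewrite -addn2 subnK; last by rewrite (leq_trans _ (ltnW
  Hk)) // leq_addl.
by rewrite -expnM ltn_exp2l // ltn_subRL addnC.
Qed.
End Shattering.

(** * Reduction to a single variable *)

Section SingleVariable.
Import mathcomp.boot.finset.
Local Open Scope set_scope.
Variables (L : language) (C : structure L).

Definition patterns (phi : form L) (ys : seq nat) (I : finType)
    (c : I -> nat -> C) : {set {set I}} :=
  [set J : {set I} | `[< exists a, forall i,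
     sat (split_assignment ys a (c i)) phi <-> i \in J >]].

(** The base of the power is at least 2, so constant factors are absorbed by the
   exponent. *)
Definition poly_patterns (phi : form L) (ys : seq nat) : Prop :=
  exists D, forall (I : finType) (c : I -> nat -> C),
    #|patterns phi ys c| <= #|I|.+2 ^ D.

Lemma poly_patterns_not_rich phi ys :
  poly_patterns phi ys -> ~ rich phi ys (@classical_sets.setT (nat -> C)).
Proof.
move=> [D HD] rT; have [n Dn] := exp_beats_poly D.
have [c _ ic] := rT n; have := HD _ c.
have -> : patterns phi ys c = [set: {set 'I_n}].
  by apply/setP => J; rewrite !inE; apply/asboolP; exact: ic.
rewrite -powersetT card_powerset cardsT !card_ord.
by rewrite leqNgt Dn.
Qed.

(** Each row is an assignment of all variables, but the objects [ys] must be the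
   same in all rows: in each of them, they are replaced by reserved variables,
   which are the objects [zs] of the new formula. *)
Lemma definable_coupled (phi : form L) (y : nat) (ys : seq nat) d
    (J : {set 'I_d}) :
  exists (psi : form L) (zs : seq nat), size zs = size ys /\
    forall b : nat -> C, exists b', forall c : nat -> nat -> C,
      sat (split_assignment zs b' (join_rows c)) psi <->
      exists a, forall k : 'I_d,
        sat (split_assignment [:: y] a (split_assignment ys b (c k))) phi <->
        k \in J.
Proof.
pose rho (w : nat) := if @unpickle (nat * nat)%type w is Some (k.+1, v) then
  if v \in ys then pickle (0, v) else w else w.
have [psi Hpsi] := definable_rename rho
  (definable_pattern phi [:: y] (fun k : 'I_d => k : nat) J).
exists psi, [seq pickle (0, v) | v <- ys]; split; first by rewrite size_map.
move=> b; exists (fun w => if @unpickle (nat * nat)%type w is Some (_,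
  v) then b v else b 0).
move=> c; apply: iff_trans (Hpsi _ _) _.
set s := split_assignment _ _ _.
suff E k : row (s \o rho) k = split_assignment ys b (c k).
  by split=> -[a Ha]; exists a => k; have := Ha k; rewrite E.
apply/funext => v; rewrite /row /= /rho pickleK /s /split_assignment.
case: (boolP (v \in ys)) => vys.
  by rewrite (map_f (fun v => pickle (0, v)) vys) pickleK.
by case: ifP => [/mapP[w _ /(pcan_inj pickleK)]//|_];
  rewrite /join_rows pickleK.
Qed.

Lemma poly_patterns_nil phi : poly_patterns phi [::].
Proof.
exists 0 => I c; rewrite expn0; apply/card_le1_eqP => J J'.
rewrite !inE => /asboolP[a Ha] /asboolP[a' Ha']; apply/setP => i.
have E b : split_assignment [::] b (c i) = c i by [].
have := Ha i; have := Ha' i; rewrite !E => H' H.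
by apply/idP/idP => iJ; [apply/H/H'|apply/H'/H].
Qed.

(** If no object in the single variable [y] separates [d] parameters, then the
   patterns of the objects [(y, ys)] with a given value of [ys] lie, by the
   Sauer-Shelah lemma, in a family of polynomial size, namely the sets all of
   whose restrictions to [d] parameters are restrictions of such patterns.
   This family depends only on the [d]-tuples of parameters on which each
   pattern is realized by some [y], that is, on the patterns that [ys] shows for
   finitely many formulas. *)
Lemma poly_patterns_cons phi y ys d :
  ~ (exists c : 'I_d -> nat -> C, independent phi [:: y] c) ->
  (forall psi zs, size zs = size ys -> poly_patterns psi zs) ->
  poly_patterns phi (y :: ys).
Proof.
move=> nd IH.
have leq_exp m n e : m <= n -> m ^ e <= n ^ e.
  by case: e => // e mn; rewrite leq_exp2r.
have /choice[psi /choice[zs H]] := @definable_coupled phi y ys d.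
have /choice[D HD] : forall J : {set 'I_d}, exists D,
    forall (I : finType) (c : I -> nat -> C),
      #|patterns (psi J) (zs J) c| <= #|I|.+2 ^ D.
  by move=> J; apply: IH; have [] := H J.
exists ((\sum_J d.+2 * D J) + d) => I c.
have [c0] := carrier_inhabited C.
pose ct (t : {ffun 'I_d -> I}) (k : nat) : nat -> C :=
  if insub k is Some i then c (t i) else fun=> c0.
have ctE t (k : 'I_d) : ct t k = c (t k) by rewrite /ct valK.
pose shows (b : nat -> C) (t : 'I_d -> I) (J : {set 'I_d}) :=
  exists a, forall k,
  sat (split_assignment [:: y] a (split_assignment ys b (c (t k)))) phi <-> k
    \in J.
(* the tuples of parameters on which each pattern is shown over [b] *)
pose theta b : {ffun {set 'I_d} -> {set {ffun 'I_d -> I}}} :=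
  [ffun J => [set t : {ffun 'I_d -> I} | `[< shows b t J >]]].
(* the sets all of whose restrictions to tuples are recorded in [th] *)
pose hull (th : {ffun {set 'I_d} -> {set {ffun 'I_d -> I}}}) : {set {set I}} :=
  [set A : {set I} | [forall t : {ffun 'I_d -> I},
    t \in th [set k | t k \in A]]].
have hullP b A : A \in hull (theta b) ->
    forall t : {ffun 'I_d -> I}, shows b t [set k | t k \in A].
  by rewrite inE => /forallP Ht t; have := Ht t; rewrite ffunE inE => /asboolP.
have card_hull b : #|hull (theta b)| <= #|I|.+1 ^ d.
  apply: sauer_shelah => e e_inj; apply: contrapT => nJ; apply: nd.
  exists (fun k => split_assignment ys b (c (e k))) => J.
  have [S [hS eS]] : exists S, S \in hull (theta b) /\ forall k,
    (e k \in S) = (k \in J).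
    apply: contrapT => nS; apply: nJ; exists J => S hS.
    apply: contrapT => nk; apply: nS; exists S; split=> // k.
    by apply/eqP; apply: contrapT => /negP nek; apply: nk; exists k.
  have [a Ha] := hullP b S hS [ffun k => e k]; exists a => k.
  by have := Ha k; rewrite inE !ffunE eS.
have pat_hull J : J \in patterns phi (y :: ys) c ->
  exists b, J \in hull (theta b).
  rewrite inE => /asboolP[a Ha]; exists a; rewrite inE; apply/forallP => t.
  rewrite ffunE inE; apply/asboolP; exists a => k.
  by rewrite inE split_assignment1 -split_assignment_cons; exact: Ha.
have theta_pat b J : theta b J \in patterns (psi J) (zs J) (fun t =>
  join_rows (ct t)).
  have [_ /(_ b)[b' Hb']] := H J.
  rewrite inE; apply/asboolP; exists b' => t; apply: iff_trans (Hb' _) _.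
  rewrite ffunE inE; split=> [[a Ha]|/asboolP[a Ha]].
    by apply/asboolP; exists a => k; have := Ha k; rewrite ctE.
  by exists a => k; rewrite ctE.
pose R := [set th | (th \in family (fun J =>
  patterns (psi J) (zs J) (fun t => join_rows (ct t)))) && (#|hull th| <=
    #|I|.+1 ^ d)].
have cardR : #|R| <= #|I|.+2 ^ (\sum_J d.+2 * D J).
  apply: (@leq_trans #|family (fun J => patterns (psi J) (zs J) (fun t =>
    join_rows (ct t)))|).
    by apply/subset_leq_card/fintype.subsetP => th; rewrite inE => /andP[].
  rewrite card_family foldrE big_image expn_sum; apply: leq_prod => J _.
  apply: leq_trans (HD J _ _) _; rewrite expnM; apply: (leq_exp).
  (* the parameters of [psi J] are the [#|I| ^ d] tuples of parameters *)
  rewrite card_ffun card_ord -(addn2 d) expnD.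
  have [n2 n_gt0] : 2 ^ 2 <= #|I|.+2 ^ 2 /\ 0 < #|I|.+2 ^ d.
    by rewrite leq_exp2r // expn_gt0.
  have nd' : #|I| ^ d <= #|I|.+2 ^ d by apply: (leq_exp); rewrite leqW.
  nia.
rewrite expnD; apply: (@leq_trans (#|R| * #|I|.+1 ^ d)); last first.
  by apply: leq_mul => //; exact: leq_exp.
apply: (@leq_trans (\sum_(th in R) #|hull th|)).
  apply: (@leq_trans #|\bigcup_(th in R) hull th|).
    apply/subset_leq_card/fintype.subsetP => J /pat_hull[b Jb].
    apply/bigcupP; exists (theta b) => //; rewrite inE card_hull andbT.
    by apply/familyP.
  elim/big_rec2: _ => [|th k U _ Uk]; first by rewrite cards0.
  by apply: leq_trans (leq_card_setU _ _) _; rewrite leq_add2l.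
rewrite -sum_nat_const; apply: leq_sum => th; rewrite inE.
by case/andP.
Qed.

(** If no formula is rich in a single object variable, then by induction on the
   number of object variables all formulas have polynomially many patterns. *)
Lemma rich_single (phi : form L) ys :
  rich phi ys (@classical_sets.setT (nat -> C)) ->
  exists psi x, rich psi [:: x] (@classical_sets.setT (nat -> C)).
Proof.
move=> rphi; apply: contrapT => nrich.
suff H n psi zs : size zs = n -> poly_patterns psi zs.
  exact: poly_patterns_not_rich (H _ phi ys erefl) rphi.
elim: n psi zs => [|n IH] psi [|z zs] //= => [_|[zsn]].
  exact: poly_patterns_nil.
have [d nd] : exists d, ~ exists c : 'I_d -> nat -> C, independent psi [:: z] c.
  apply: contrapT => nd; apply: nrich; exists psi, z => d.
  apply: contrapT => nc; apply: nd; exists d => -[c ic]; apply: nc.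
  by exists c.
by apply: (poly_patterns_cons nd) => psi' zs' szs'; apply: IH; rewrite szs'.
Qed.
End SingleVariable.

(** * The type space *)

Section TypeSpace.
Import mathcomp.finmap.finmap.
Variables (L : language) (M : structure L) (x : nat).
Local Notation X := (type_space M x).

Lemma type_set_neg (p : X) q : type_set p (pneg q) <-> ~ type_set p q.
Proof.
have [_ pfin pcpl] := type_setP p; split=> [pn pq|npq].
  have [||a Ha] := pfin [set q; pneg q].
  - by rewrite finite_setU.
  - by move=> _ [->|->].
  have : psat x a (pneg q) by apply: Ha; right.
  by apply; apply: Ha; left.
by have [] := pcpl q.
Qed.

Lemma type_space_ext (p q : X) : type_set p = type_set q -> p = q.
Proof.
case: p => p cp; case: q => q cq /= E; subst q.
by congr TypeSpace; exact: Prop_irrelevance.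
Qed.

Lemma open_clopen_of q : open (@clopen_of L M x q).
Proof.
exists [set clopen_of q].
  move=> _ ->; exists (finmap.fset1 (clopen_of q : set X)).
    by move=> A /finmap.fset1P->; exact/mem_set/imageT.
  apply/seteqP; split=> p; first by move=> /(_ (clopen_of q)); apply;
    apply/finmap.fset1P.
  by move=> pq A /finmap.fset1P->.
by rewrite bigcup_set1.
Qed.

Lemma nbhs_agree (p : X) q : nbhs p [set r : X | type_set r q <-> type_set p q].
Proof.
have [pq|npq] := pselect (type_set p q).
  have pU : clopen_of q p by [].
  by apply: filterS (open_nbhs_nbhs (conj (open_clopen_of q) pU)) => r.
have pU : clopen_of (pneg q) p by apply/type_set_neg.
apply: filterS (open_nbhs_nbhs (conj (open_clopen_of (pneg q)) pU)).
by move=> r /type_set_neg rq; split.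
Qed.

Lemma nbhs_type (p : X) (V : set X) : nbhs p V -> exists F : set (pform M),
  [/\ finite_set F, F `<=` type_set p &
      forall p' : X, F `<=` type_set p' -> V p'].
Proof.
rewrite nbhsE => -[_ [[D Dfin <-] [A DA Ap]] AV].
have [E EB EA] := Dfin A DA.
have {}EA : \bigcap_(B in [set` E]) B = A :> set X := EA.
have {}Ap : (\bigcap_(B in [set` E]) B) p by rewrite EA.
have [c0] := carrier_inhabited M.
have /choice[g Hg] : forall B : set X, exists q, B \in E -> B = clopen_of q.
  move=> B; have [/EB/set_mem[q _ <-]|nB] := boolP (B \in E); first by exists q.
  by exists (fbot, (fun=> c0)).
exists (g @` [set` E]); split.
- by apply: finite_image; exact: finite_fset.
- by move=> _ [B EB' <-]; move: (Ap B EB'); rewrite {1}(Hg B EB').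
- move=> p' Fp'; apply: AV; exists A => //.
  suff : (\bigcap_(B in [set` E]) B) p' by rewrite EA.
  move=> B EB'.
  by rewrite (Hg B EB'); apply: Fp'; exists B.
Qed.

Section Limits.
Variables (I : Type) (U : set_system I) (UU : UltraFilter U) (h : I -> X).

Lemma limit_typeP : complete_type x setT [set q | U [set i | type_set (h i) q]].
Proof.
split=> //.
  move=> F finF FU.
  have : U (\bigcap_(q in F) [set i | type_set (h i) q]).
    exact: filter_bigcap_finite.
  move=> /filter_ex[i Hi]; have [_ pfin _] := type_setP (h i).
  by apply: pfin => // q /Hi.
move=> q _; have [Uq|Uq] := in_ultra_setVsetC [set i | type_set (h i) q] UU.
  by left.
by right; apply: filterS Uq => i /type_set_neg.
Qed.

Definition limit_type : X := TypeSpace limit_typeP.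

Lemma nbhs_limit_type (V : set X) : nbhs limit_type V -> U (h @^-1` V).
Proof.
move=> /nbhs_type[F [finF FU FV]].
have : U (\bigcap_(q in F) [set i | type_set (h i) q]).
  exact: filter_bigcap_finite.
by apply: filterS => i Hi; apply: FV => q /Hi.
Qed.
End Limits.

Lemma type_space_compact : compact [set: X].
Proof.
rewrite compact_ultra => U UU _; exists (limit_type UU id); split=> //.
by move=> V /nbhs_limit_type.
Qed.

Lemma type_space_hausdorff : hausdorff_space X.
Proof.
move=> p q pq; apply: type_space_ext; apply/seteqP.
suff H (p' q' : X) : cluster (nbhs p') q' -> type_set p' `<=` type_set q'.
  by split; apply: H => // A B nA nB; rewrite setIC; exact: pq.
move=> p'q' r p'r; apply: contrapT => /type_set_neg q'r.
have [||s [s1 s2]] := p'q' (clopen_of r) (clopen_of (pneg r)).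
- exact: open_nbhs_nbhs (conj (open_clopen_of r) p'r).
- exact: open_nbhs_nbhs (conj (open_clopen_of (pneg r)) q'r).
by move/type_set_neg: s2.
Qed.

(** By compactness; the smallness of the image of a set is thus a matter of
   finitely many formulas. *)
Lemma uniformity_type (W : set (X * X)) : uniformity W ->
  exists2 Q : set (pform M), finite_set Q &
    forall a b : X, (forall q, Q q -> type_set a q <-> type_set b q) ->
      W (a, b).
Proof.
move=> uW.
pose P (A : set X) := exists2 Q : set (pform M), finite_set Q &
  forall a b : X, A a -> (forall q, Q q -> type_set a q <-> type_set b q) ->
    W (a, b).
suff [Q finQ HQ] : P setT by exists Q => // a b; exact: HQ.
apply: compact_ideal; first exact: type_space_compact.
- by move=> A B AB [Q finQ HQ]; exists Q => // a b /AB; exact: HQ.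
- by exists set0.
- move=> A B [Q finQ HQ] [Q' finQ' HQ']; exists (Q `|` Q').
    by rewrite finite_setU.
  move=> a b [Aa|Ba] ab; [apply: HQ|apply: HQ'] => // q Qq; apply: ab;
    by [left|right].
- move=> p; have [[V V'] /= [nV nV'] VW] := uW p.
  have [F [finF Fp FV]] := nbhs_type (filterI nV nV').
  have nF : nbhs p (\bigcap_(q in F) clopen_of q).
    apply: filter_bigcap_finite => // q /Fp pq.
    exact: open_nbhs_nbhs (conj (open_clopen_of q) pq).
  exists (\bigcap_(q in F) clopen_of q) => //; exists F => // a b Fa ab.
  apply: VW; split=> /=; first by have [] := FV a Fa.
  by have [] := FV b (fun q Fq => iffLR (ab q Fq) (Fa q Fq)).
Qed.

Lemma realized_complete (a : M) :
  complete_type x setT [set q | psat x a q].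
Proof.
split=> //; first by move=> F _ Fa; exists a.
by move=> q _; have [|n] := pselect (psat x a q); [left|right].
Qed.

Definition realized_type (a : M) : X := TypeSpace (realized_complete a).

Lemma ellis_approx (f : X -> X) (E : set X) (q : pform M) :
  ellis (@type_act L M x) f -> finite_set E ->
  exists g : aut M, forall p, E p ->
    type_set (type_act g p) q <-> type_set (f p) q.
Proof.
move=> Ef finE.
pose V (p : X) : set X := if `[< type_set (f p) q >] then clopen_of q else
  clopen_of (pneg q).
have nV p : nbhs (f p) (V p).
  rewrite /V; case: asboolP => [fq|/type_set_neg fq].
    exact: open_nbhs_nbhs (conj (open_clopen_of q) fq).
  exact: open_nbhs_nbhs (conj (open_clopen_of (pneg q)) fq).
have nE : nbhs (f : {ptws X -> X}) (\bigcap_(p in E) [set h : {ptws X ->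
  X} | V p (h p)]).
  apply: filter_bigcap_finite => // p _.
  exact: (@proj_continuous X (fun=> X) p f _ (nV p)).
have [_ [[g _ <-] Hg]] := Ef _ nE.
exists g => p Ep; have := Hg p Ep; rewrite /= /V.
case: asboolP => [fq|nfq]; first by move=> gq; split.
by move=> /type_set_neg ngq; split.
Qed.

Lemma ellis_limit (I : Type) (U : set_system I) (UU : UltraFilter U)
    (g : I -> aut M) :
  ellis (@type_act L M x) (fun p => limit_type UU (fun i => type_act (g i) p)).
Proof.
set f := (fun p => _ : X).
have cvf : (fun i => type_act (g i) : {ptws X -> X}) @ U --> (f : {ptws X ->
  X}).
  apply/cvg_sup => p W.
  have /= -> := @nbhsE (initial_topology (fun h : {ptws X -> X} => h p)) f.
  case=> B [[V oV <-] Vf] /filterS; apply.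
  exact: (nbhs_limit_type (open_nbhs_nbhs (conj oV Vf))).
move=> B /cvf UB; have [i Bi] := @filter_ex _ U _ _ UB.
by exists (type_act (g i)); split=> //; exists (g i).
Qed.
End TypeSpace.

(** * Tameness and independence *)

(** An entourage depends on finitely many formulas.  If each of them could be made
   constant on the image of a smaller open part of any open part of [D], then
   all of them could be, one after the other, and the image would become
   small. *)
Lemma not_fragmented_oscillates L (M : structure L) (x : nat)
    (f : type_space M x -> type_space M x) :
  ~ fragmented f -> exists (q : pform M) (D : set (type_space M x)),
    D !=set0 /\ forall p N, D p -> nbhs p N -> exists a b,
      [/\ D a /\ N a, D b /\ N b, type_set (f a) q & ~ type_set (f b) q].
Proof.
move=> /existsNP[D /existsNP[W /not_implyP[cD /not_implyP[D0
  /not_implyP[uW H]]]]].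
have [Q finQ QW] := uniformity_type uW.
apply: contrapT => noq.
have shrink q (V : set (type_space M x)) : open V -> D `&` V !=set0 ->
    exists V', [/\ open V', V' `<=` V, D `&` V' !=set0 &
      forall a b, (D `&` V') a -> (D `&` V') b ->
        type_set (f a) q -> type_set (f b) q].
  move=> oV DV; apply: contrapT => nV'; apply: noq; exists q, (D `&` V).
  split=> // p N [Dp Vp]; rewrite nbhsE => -[N' [oN' N'p] N'N].
  apply: contrapT => nab; apply: nV'; exists (V `&` N'); split.
  - exact: openI.
  - by move=> ? [].
  - by exists p.
  move=> a b [Da [Va N'a]] [Db [Vb N'b]] fa; apply: contrapT => nfb.
  by apply: nab; exists a, b; split=> //; split=> //; exact: N'N.
have [l Ql] := finite_set_seq finQ.
have [V [oV DV HV]] : exists V, [/\ open V, D `&` V !=set0 &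
    forall q, List.In q l -> forall a b, (D `&` V) a -> (D `&` V) b ->
      type_set (f a) q -> type_set (f b) q].
  elim: l {Ql} => [|q l [V [oV DV HV]]].
    by exists setT; split=> //; [exact: openT|rewrite setIT].
  have [V' [oV' V'V DV' HV']] := shrink q V oV DV.
  exists V'; split=> // r /= [<-//|lr] a b [Da Va] [Db Vb].
  by apply: HV lr _ _ _ _; split=> //; exact: V'V.
apply: H; exists V; split=> // a b Da Db; apply: QW => q /Ql lq.
by split; exact: HV.
Qed.

(** By pointwise approximation of [f] by automorphisms at finitely many points,
   the oscillation allows one to extend an independent family by a conjugate of
   the parameters of [q]: each nonempty open set given by the previous
   parameters is split by the new ones. *)
Lemma not_fragmented_rich L (C : structure L) (x : nat)
    (f : type_space C x -> type_space C x) :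
  ellis (@type_act L C x) f -> ~ fragmented f ->
  exists phi, rich phi [:: x] (@setT (nat -> C)).
Proof.
move=> Ef /not_fragmented_oscillates[[phi s] [D [[p0 Dp0] osc]]].
exists phi.
suff tree n : exists c : nat -> nat -> C, forall J : {set 'I_n},
    exists p, D p /\ forall i : 'I_n, type_set p (phi, c i) <-> i \in J.
  move=> n; have [c Hc] := tree n; exists (fun i => c i) => // J.
  have [p [_ Hp]] := Hc J; have [_ pfin _] := type_setP p.
  pose q (i : 'I_n) : pform C := (if i \in J then phi else fneg phi, c i).
  have [||a Ha] := pfin (range q).
  - exact/finite_image/finite_finset.
  - move=> _ [i _ <-]; rewrite /q; case: ifP => iJ; first exact/Hp.
    by apply/(@type_set_neg _ _ _ p (phi, c i)) => /Hp; rewrite iJ.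
  exists (fun=> a) => i; rewrite split_assignment1.
  have := Ha (q i) (imageT _ _); rewrite /psat /q /=.
  by case: ifP => iJ Hi; split=> // /Hi[].
elim: n => [|n [c Hc]].
  by exists (fun _ _ => s 0) => J; exists p0; split=> // -[].
have /choice[ab Hab] : forall J : {set 'I_n}, exists ab,
    [/\ D ab.1 /\ forall i : 'I_n, type_set ab.1 (phi, c i) <-> i \in J,
        D ab.2 /\ forall i : 'I_n, type_set ab.2 (phi, c i) <-> i \in J,
        type_set (f ab.1) (phi, s) & ~ type_set (f ab.2) (phi, s)].
  move=> J; have [p [Dp Hp]] := Hc J.
  have nN : nbhs p [set r | forall i : 'I_n, type_set r (phi, c i) <-> i \in J].
    suff near_i (i : 'I_n) : nbhs p [set r | type_set r (phi, c i) <-> i \in J].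
      exact: (filter_forall _ near_i).
    apply: filterS (nbhs_agree p (phi, c i)) => r /= rp.
    exact: iff_trans rp (Hp i).
  by have [a [b [? ? ? ?]]] := osc p _ Dp nN; exists (a, b).
have [|g Hg] := ellis_approx (phi, s) Ef
    (E := range (fun J => (ab J).1) `|` range (fun J => (ab J).2)).
  by rewrite finite_setU; split; exact/finite_image/finite_finset.
exists (fun i => if i < n then c i else aut_inv g \o s) => J.
pose J' : {set 'I_n} := finset (fun i => widen_ord (leqnSn n) i \in J).
have [[Da Ha] [Db Hb] fa fb] := Hab J'.
have low (p : type_space C x) (i : 'I_n.+1) :
    (forall i : 'I_n, type_set p (phi, c i) <-> i \in J') -> i < n ->
    type_set p (phi, c i) <-> i \in J.
  move=> Hp ilt; have := Hp (Ordinal ilt); rewrite finset.inE.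
  by suff -> : widen_ord (leqnSn n) (Ordinal ilt) = i by []; apply: val_inj.
have max (i : 'I_n.+1) : (i < n) = false -> i = ord_max.
  move=> /negbT; rewrite -leqNgt => ni; apply: val_inj => /=.
  by apply/eqP; rewrite eqn_leq ni -ltnS ltn_ord.
have [mJ|mJ] := boolP (ord_max \in J).
  exists (ab J').1; split=> // i; case: ifP => [/low|/max ->]; first exact.
  by split=> // _; apply/(Hg (ab J').1); [left; exists J'|].
exists (ab J').2; split=> // i; case: ifP => [/low|/max ->]; first exact.
split=> [/(Hg (ab J').2 (or_intror (imageT _ _)))//|].
by rewrite (negPf mJ).
Qed.

Section NotTame.
Variables (L : language) (C : structure L) (x : nat) (phi : form L).
Variable c : nat -> nat -> C.
Local Notation X := (type_space C x).

Let trace (p : X) : set nat := [set i | type_set p (phi, c i)].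

Let trace_near (p : X) (i : nat) :
  nbhs p [set r | trace r i <-> trace p i].
Proof. exact: nbhs_agree. Qed.

(** By compactness there is a minimal closed set on which the trace map is onto;
   [N] is its complement. *)
Lemma irreducible_trace :
  (forall J, exists p, trace p = J) ->
  exists N : set X, [/\ open N, forall J, exists p, ~ N p /\ trace p = J &
    forall V, open V -> ~ (V `<=` N) ->
      exists J, forall p, trace p = J -> N p \/ V p].
Proof.
move=> onto.
pose P (N : set X) := open N /\ forall J, exists p, ~ N p /\ trace p = J.
have [F FP Ftot|N [[oN Nonto] Nmax]] := @Zorn_bigcup _ P.
  split; first by apply: bigcup_open => N /FP[].
  move=> J; apply: contrapT => nJ.
  have [[N0 FN0]|F0] := pselect (exists N, F N); last first.
    have [p pJ] := onto J; apply: nJ; exists p; split=> // -[N FN].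
    by case: F0; exists N.
  pose ideal (A : set X) := exists2 N, F N & forall p, A p -> trace p = J ->
    N p.
  suff [N /FP[_ /(_ J)[p [nNp pJ]]] H] : ideal setT by apply: nNp; exact: H.
  apply: compact_ideal; first exact: type_space_compact.
  - by move=> A B AB [N FN HN]; exists N => // p /AB; exact: HN.
  - by exists N0.
  - move=> A B [N FN HN] [N' FN' HN']; have [s|s] := Ftot _ _ FN FN'.
      by exists N' => // p [Ap|Bp] pJ; [exact/s/HN|exact: HN'].
    by exists N => // p [Ap|Bp] pJ; [exact: HN|exact/s/HN'].
  - move=> p; have [[N FN Np]|nNp] := pselect (exists2 N, F N & N p).
      have [oN _] := FP _ FN; exists N; first exact: open_nbhs_nbhs.
      by exists N.
    have [i ni] : exists i, ~ (trace p i <-> J i).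
      apply: contrapT => ni; apply: nJ; exists p; split.
        by move=> [N FN Np]; apply: nNp; exists N.
      apply/seteqP; split=> i pi; apply: contrapT => Ji; apply: ni; exists i.
        by move=> [/(_ pi)].
      by move=> [_ /(_ pi)].
    exists [set r | trace r i <-> trace p i]; first exact: trace_near.
    by exists N0 => // r /= ri rJ; case: ni; rewrite -rJ; exact: iff_sym.
exists N; split=> // V oV nVN.
apply: contrapT => nJ; apply: (Nmax (N `|` V)).
  split; first exact: subsetUl.
  by move=> s; apply: nVN => p Vp; apply: s; right.
split; first exact: openU.
move=> J; apply: contrapT => nJ'; apply: nJ; exists J => p pJ.
by apply: contrapT => nNV; apply: nJ'; exists p.
Qed.

(** Let [D] be a minimal closed set on which the trace map is onto.  If an open
   set [V] meets [D], the traces of the types in both contain a nonempty open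
   part of Cantor space, by minimality; so some trace belongs to a given
   nonprincipal ultrafilter, and some does not.  Hence the ultrafilter limit of
   conjugations is not fragmented on [D]. *)
Lemma independent_not_tame :
  (forall J, exists a, forall i, sat (upd (c i) x a) phi <-> J i) ->
  (forall k, exists g : aut C, c 0 = g \o c k) ->
  ~ tame (@type_act L C x).
Proof.
move=> indep /choice[g Hg] tameC.
have gK k : aut_inv (g k) \o c 0 = c k.
  by apply/funext => v; rewrite (Hg k) /= aut_funK.
have onto J : exists p, trace p = J.
  have [a Ha] := indep J; exists (realized_type x a).
  by apply/seteqP; split=> i /Ha.
have [N [oN Nonto Nmin]] := irreducible_trace onto.
have [U [UU infU]] := ultraFilterLemma eventually_filter.
pose f (p : X) : X := limit_type UU (fun i => type_act (g i) p).
have fE p : type_set (f p) (phi, c 0) <-> U (trace p).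
  suff -> : trace p = [set i | type_set (type_act (g i) p) (phi, c 0)] by [].
  by apply/funext => i; rewrite /trace /= /act_set /= gK.
pose W := [set p : X * X | type_set p.1 (phi, c 0) <-> type_set p.2 (phi, c 0)].
have uW : uniformity W.
  move=> p; pose S := [set r : X | type_set r (phi, c 0) <-> type_set p (phi,
    c 0)].
  exists (S, S); first by split; exact: nbhs_agree.
  by move=> [r r'] [/= H H']; exact: iff_trans H (iff_sym H').
have [p0 [nNp0 _]] := Nonto setT.
have [||V [oV [p [nNp Vp]] HV]] := tameC f (@ellis_limit _ _ x _ _ UU g) (~` N)
  W _ _ uW.
- exact: open_closedC.
- by exists p0.
have [|J0 HJ0] := Nmin V oV; first by move=> /(_ p Vp).
have [n Hn] : exists n, forall r, (forall i, i < n -> trace r i <-> J0 i) ->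
  N r \/ V r.
  pose ideal (A : set X) := exists n, forall r, A r ->
    (forall i, i < n -> trace r i <-> J0 i) -> N r \/ V r.
  suff [n Hn] : ideal setT by exists n => r; exact: Hn.
  apply: compact_ideal; first exact: type_space_compact.
  - by move=> A B AB [n Hn]; exists n => r /AB; exact: Hn.
  - by exists 0.
  - move=> A B [n Hn] [m Hm]; exists (n + m) => r [Ar|Br] H.
      by apply: Hn => // i lt_i; apply: H; exact: leq_trans lt_i (leq_addr _ _).
    by apply: Hm => // i lt_i; apply: H; exact: leq_trans lt_i (leq_addl _ _).
  - move=> r; have [NVr|nNVr] := pselect (N r \/ V r).
      exists (N `|` V); first exact: open_nbhs_nbhs (conj (openU oN oV) NVr).
      by exists 0.
    have [i ni] : exists i, ~ (trace r i <-> J0 i).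
      apply: contrapT => ni; apply: nNVr; apply: HJ0.
      apply/seteqP; split=> i ri; apply: contrapT => Ji; apply: ni; exists i.
        by move=> [/(_ ri)].
      by move=> [_ /(_ ri)].
    exists [set r' | trace r' i <-> trace r i]; first exact: trace_near.
    exists i.+1 => r' /= r'i /(_ i (leqnn _)) r'J; case: ni.
    exact: iff_trans (iff_sym r'i) r'J.
have large : U [set i | n <= i] by apply: infU; exact: nbhs_infty_ge.
have inV J : (forall i, i < n -> J i <-> J0 i) ->
  exists2 r, (~` N `&` V) r & trace r = J.
  move=> JJ0; have [r [nNr rJ]] := Nonto J; exists r => //; split=> //.
  by have [|//|//] := Hn r; rewrite rJ.
(* the largest and the smallest traces agreeing with [J0] below [n] *)
have [r1 Nr1 r1J] := inV [set i | i < n -> J0 i] (fun i lt_i => conj (fun H =>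
  H lt_i) (fun H _ => H)).
have [r2 Nr2 r2J] := inV [set i | i < n /\ J0 i] (fun i lt_i =>
  conj (@proj2 _ _) (conj lt_i)).
have /= W12 := HV _ _ Nr1 Nr2.
have /fE/W12/fE : U (trace r1).
  by rewrite r1J; apply: filterS large => i /= ni; rewrite ltnNge ni.
rewrite r2J => U2; have [i [/= ni [lt_i _]]] := filter_ex (filterI large U2).
by move: lt_i; rewrite ltnNge ni.
Qed.
End NotTame.

Lemma rich_not_tame L (C : structure L) (x : nat) (phi : form L) :
  monster C -> rich phi [:: x] (@setT (nat -> C)) -> ~ tame (@type_act L C x).
Proof.
move=> hM /(rich_sequence hM)[c [ic tc]].
apply: (independent_not_tame (independent_realize hM ic)) => k.
apply: monster_conjugate => // psi ck; apply: contrapT => nc0.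
exact: (tc k (fneg psi)).
Qed.

Theorem corollary4p16 (L : language) (T : set (form L)) (C : structure L)
    (hT : complete_theory T) (hC : models C T) (hM : monster C) :
  [<-> NIP T;
       forall x : nat, tame (@type_act L C x);
       forall x : nat, elt (beta_system (@type_act L C x)) infty;
       forall (x : nat) (f : type_space C x -> type_space C x),
         ellis (@type_act L C x) f ->
         elt (beta f) (succ_card (weight (type_space C x)))].
Proof.
tfae.
- move=> nip x f Ef; apply: contrapT => /(not_fragmented_rich Ef)[phi rphi].
  have [xs IP] := rich_has_IP hC hM rphi; exact: nip IP.
- by move=> tameC x; exact: tame_beta_bounded.
- move=> bounded x f Ef; apply: beta_lt_succ_weight.
  + exact: type_space_compact.
  + exact: type_space_hausdorff.
  + have [a [_ Ha]] := bounded x; exists a; split=> // d fd; apply: Ha.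
    by exists f.
- move=> small phi xs /(has_IP_rich hT hC)[ys /rich_single[psi [x rpsi]]].
  apply: (rich_not_tame hM rpsi) => f Ef; apply: contrapT.
  move=> /not_fragmented_beta[W uW betaW].
  have [a [_ Ha]] := small x f Ef; apply: (@olt_irrefl a); apply: Ha.
  by exists W.
Qed.
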